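(* There exists a norm $\|\cdot\|\in\mathcal N$ such that, for $X=(c_{00},\|\cdot\|)$ and all $x\in c_{00}$, $$\|x\|=\max\bigl(\|x\|_\infty,\ \|x\|_{C^X}\bigr).$$ Moreover the completion of $X$ is reflexive.
   Context: **Notation.** All spaces are real; $\mathbb N=\{1,2,\dots\}$. $c_{00}$ is the space of finitely supported real sequences, with unit vectors $(e_i)$ and biorthogonal functionals $(e_i^* )$. $\operatorname{supp}x=\{j:x(j)\ne0\}$; for $E\subseteq\mathbb N$, $Ex$ is $x$ restricted to $E$ (and $0$ off $E$). An element $x^*\in c_{00}$ is also regarded as the functional $\sum_i x^*(i)e_i^*$. For nonzero $x,y\in c_{00}$, $x<y$ means $\max\operatorname{supp}x<\min\operatorname{supp}y$ (same notation for functionals). $B(\cdot)$ denotes the closed unit ball; for a set $A$ of functionals $\|x\|_A=\sup\{|x^*(x)|:x^*\in A\}$. $f(x)=\log_2(x+1)$. $\mathcal N$ is the set of norms on $c_{00}$ for which $(e_i)$ is a normalized monotone basis of the completion and $\|e_i^*\|=1$ for all $i$. **Parameters.** Fix a countable set $H\subset c_{00}\cap[-1,1]^{\mathbb N}$ of nonzero elements such that: (H1) $H$ is dense in $c_{00}\cap[-1,1]^{\mathbb N}$ in the $\ell_1$-norm; (H2) if $a\in H$, $I$ is an interval of integers and $Ia\ne0$ then $Ia\in H$; (H3) if $a_1<\dots<a_n$ are in $H$ then $\sum_{i=1}^na_i$, $\frac1{f(n)}\sum_{i=1}^na_i$, $\frac1n\sum_{i=1}^na_i$ are in $H$. Fix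 a strictly increasing sequence $M=(M_n)\subseteq\mathbb N$ with $M_1=2$. Fix an injection $\sigma:\{(a_1,\dots,a_n):n\in\mathbb N,\ a_1<\dots<a_n,\ a_i\in H\}\to\mathbb N$ with: ($\sigma_1$) if $a_1<\dots<a_n$ are in $H$, $I$ is an interval in $\mathbb N$ and $\{i\le n:Ia_i\neq0\}=[j_1,j_2]\ne\emptyset$, then $\sigma(Ia_{j_1},\dots,Ia_{j_2})\le\sigma(a_1,\dots,a_n)$; ($\sigma_2$) $\max\operatorname{supp}a_n<\sigma(a_1,\dots,a_n)$; ($\sigma_3$) $\sum_{n\in\operatorname{Im}(\sigma)}\frac1{f(n)}<\infty$ (hence $\sum_{n\in\operatorname{Im}(\sigma)}n^{-1/p}<\infty$ for $1\le p<\infty$); ($\sigma_4$) for $m\in\operatorname{Im}(\sigma)$ with predecessor $\bar m$ and successor $\bar{\bar m}$ in $\operatorname{Im}(\sigma)$, and $\ell\in[1,\bar m]\cup[\bar{\bar m},\infty)$, the quantity $2\left[\frac{f(m)}m+\frac1{f(\ell)}+\frac{f(m)}m\frac{\min(\ell,m)}{f(\ell)}\right]$ is at most $\frac3{f(\ell)}$ if $\ell<m$ and at most $\frac{3f(m)}m$ if $\ell>m$. (Such $H,\sigma$ exist.) **Admissibility.** For a sequence $\mathcal D=(D_i)$ of subsets of $H$, $(x_1^*,\dots,x_n^* )$ is $(\mathcal D,M,\sigma)$-admissible if $x_1^*<\dots<x_n^*$, $x_1^*\in\bigcup_{i\ge M_n}D_i$, and $x_{i+1}^*\in D_{\sigma(x_1^*,\dots,x_i^*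 )}$ for $1\le i<n$. **The sets $A,B,C$.** For $\|\cdot\|\in\mathcal N$ and $X=(c_{00},\|\cdot\|)$ put, for $m\ge2$, $A_m^X=\{\frac1m\sum_{i=1}^ma_i^*: a_i^*\in H\cap B(X^* ),\ a_1^*<\dots<a_m^*\}$, $A^X=\bigcup_{m\ge2}A_m^X$, $\tilde A_m^X=\bigcup_{n\ge m}A_n^X$, $\tilde{\mathfrak A}^X=(\tilde A_m^X)_{m\ge2}$; for $m\ge2$, $B_m^X=\{\frac1{f(m)}\sum_{i=1}^ma_i^*:(a_1^*,\dots,a_m^* )\subseteq A^X$ is $(\tilde{\mathfrak A}^X,M,\sigma)$-admissible$\}$, $B^X=\bigcup_{m\ge2}B_m^X$, $\mathfrak B^X=(B_m^X)_{m\ge2}$; for $m\ge1$, $C_m^X=\{\frac1{f(m)}\sum_{i=1}^ma_i^*:(a_1^*,\dots,a_m^* )\subseteq B^X$ is $(\mathfrak B^X,M,\sigma)$-admissible$\}$, $C^X=\bigcup_{m\ge1}C_m^X$. *)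

(* Defs.v *)
From HB Require Import structures.
From mathcomp Require Import all_boot all_order all_algebra.
From mathcomp Require Import all_classical all_reals all_analysis.

Set Implicit Arguments.
Unset Strict Implicit.
Unset Printing Implicit Defensive.

Import Order.TTheory GRing.Theory Num.Theory.
Import numFieldNormedType.Exports.

Local Open Scope classical_set_scope.
Local Open Scope ring_scope.

Section C00.
Variable R : realType.

(* Coordinates are indexed by {1, 2, ...}: the value at 0 is required to vanish,
   so that supports are sets of positive integers. *)
Definition c00_pred : {pred (nat -> R^o)} :=
  mem [set x : nat -> R^o | x 0%N = 0 /\ finite_set [set j | x j != 0]].

Lemma c00_predP (x : nat -> R^o) :
  reflect (x 0%N = 0 /\ finite_set [set j | x j != 0]) (x \in c00_pred).
Proof. by apply: (iffP idP) => [/set_mem|/mem_set]. Qed.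

Fact c00_submod_closed : submod_closed c00_pred.
Proof.
split.
  apply/c00_predP; split=> //.
  rewrite (_ : [set j | _] = set0) //.
  by apply/seteqP; split=> // j /=; rewrite eqxx.
move=> c x y /c00_predP[x0 xf] /c00_predP[y0 yf].
have E j : (c *: x + y) j = c * x j + y j by [].
apply/c00_predP; split; first by rewrite E x0 y0 mulr0 addr0.
apply: (sub_finite_set _ (_ : finite_set ([set j | x j != 0] `|` [set j | y j != 0]))).
  move=> j /=; case: (eqVneq (x j) 0) => [xj|]; last by left.
  case: (eqVneq (y j) 0) => [yj|]; last by right.
  by rewrite E xj yj mulr0 addr0 eqxx.
by rewrite finite_setU.
Qed.

HB.instance Definition _ :=
  GRing.isSubmodClosed.Build R (nat -> R^o) c00_pred c00_submod_closed.

Record c00 := C00 { c00_val :> nat -> R^o; c00_valP : c00_val \in c00_pred }.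

HB.instance Definition _ := [isSub for c00_val].
HB.instance Definition _ := [Choice of c00 by <:].
HB.instance Definition _ := [SubChoice_isSubLmodule of c00 by <:].

Definition supp (x : c00) : set nat := [set j | x j != 0].

Fact unitv_subproof (i : nat) :
  (fun j => (j == i.+1)%:R : R^o) \in c00_pred.
Proof.
apply/c00_predP; split=> //.
apply: (sub_finite_set _ (finite_set1 i.+1)) => j /=.
by case: (eqVneq j i.+1) => //= _; rewrite ?eqxx.
Qed.

(* [unitv i] is the unit vector e_{i+1}, so that [unitv] enumerates e_1, e_2, ... *)
Definition unitv (i : nat) : c00 := C00 (unitv_subproof i).

Fact restr_subproof (E : set nat) (x : c00) :
  (fun j => if j \in E then x j else 0) \in c00_pred.
Proof.
have /c00_predP[x0 xf] := c00_valP x; apply/c00_predP; split.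
  by rewrite x0; case: ifP.
by apply: (sub_finite_set _ xf) => j /=; case: ifP => // _; rewrite eqxx.
Qed.

Definition restr (E : set nat) (x : c00) : c00 := C00 (restr_subproof E x).

Definition interval_of_nat (I : set nat) : Prop :=
  forall i j k, I i -> I k -> (i <= j <= k)%N -> I j.

Definition pairing (a x : c00) : R := \sum_(i \in [set: nat]) a i * x i.

Definition sup_norm (x : c00) : \bar R :=
  ereal_sup [set `|x i|%:E | i in [set: nat]].

Definition l1_norm (x : c00) : R := \sum_(i \in [set: nat]) `|x i|.

Definition set_norm (A : set c00) (x : c00) : \bar R :=
  ereal_sup [set `|pairing a x|%:E | a in A].

(* max supp x < min supp y, for nonzero x and y *)
Definition c00_lt : rel c00 := fun x y =>
  [&& x != 0, y != 0 & `[< forall i j, supp x i -> supp y j -> (i < j)%N >]].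

Definition blocks (H : set c00) : set (seq c00) :=
  [set s | [/\ s <> [::], sorted c00_lt s & forall a, a \in s -> H a]].

Definition is_norm (N : c00 -> R) : Prop :=
  [/\ forall x y, N (x + y) <= N x + N y,
      forall c x, N (c *: x) = `|c| * N x &
      forall x, N x = 0 -> x = 0].

(* Norm of [a], regarded as a functional, in the dual of (c00, N). *)
Definition dual_norm (N : c00 -> R) (a : c00) : \bar R :=
  ereal_sup [set `|pairing a x|%:E | x in [set x | N x <= 1]].

Definition dual_ball (N : c00 -> R) : set c00 :=
  [set a | (dual_norm N a <= 1)%E].

(* A Banach space containing (c00, N) isometrically as a dense subspace; it is
   unique up to an isometric isomorphism fixing c00. *)
Record completion (N : c00 -> R) := Completion {
  completion_space :> completeNormedModType R;
  completion_emb : {linear c00 -> completion_space};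
  completion_isometry : forall x, `|completion_emb x| = N x;
  completion_dense : dense (range completion_emb) }.

End C00.

Section Banach.
Variable R : realType.
Variable Y : completeNormedModType R.

Definition schauder_basis (b : nat -> Y) : Prop :=
  forall y : Y, exists! a : nat -> R,
    (series (fun i => a i *: b i) : nat -> Y) @ \oo --> y.

Definition normalized_monotone_basis (b : nat -> Y) : Prop :=
  [/\ schauder_basis b,
      forall i, `|b i| = 1 &
      forall (a : nat -> R) m n, (m <= n)%N ->
        `|series (fun i => a i *: b i) m| <= `|series (fun i => a i *: b i) n|].

Definition dual : set (Y -> R^o) := [set g | linear g /\ continuous g].

Definition functional_norm (g : Y -> R^o) : R :=
  sup [set `|g y| | y in [set y | `|y| <= 1]].

(* The bidual, as functions on Y -> R^o of which only the values on [dual] matter. *)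
Definition bidual : set ((Y -> R^o) -> R) :=
  [set phi |
    (forall c g h, dual g -> dual h -> phi (c *: g + h) = c * phi g + phi h) /\
    exists K, forall g, dual g -> `|phi g| <= K * functional_norm g].

Definition reflexive_space : Prop :=
  forall phi, bidual phi -> exists y, forall g, dual g -> phi g = g y.

End Banach.

Section Construction.
Variable R : realType.

Definition logf (x : R) : R := ln (x + 1) / ln 2.

Definition class_N (N : c00 R -> R) : Prop :=
  [/\ is_norm N,
      exists Y : completion N,
        normalized_monotone_basis (fun i => completion_emb Y (unitv R i)) &
      forall i, dual_norm N (unitv R i) = 1%E].

Definition H_conditions (H : set (c00 R)) : Prop :=
  [/\ countable H,
      forall a, H a -> a != 0 /\ forall i, `|a i| <= 1,
      forall x : c00 R, (forall i, `|x i| <= 1) ->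
        forall eps : R, 0 < eps -> exists2 a, H a & l1_norm (x - a) < eps,
      forall a I, H a -> interval_of_nat I -> restr I a != 0 -> H (restr I a) &
      forall s, blocks H s ->
        [/\ H (\sum_(a <- s) a),
            H ((logf (size s)%:R)^-1 *: \sum_(a <- s) a) &
            H ((size s)%:R^-1 *: \sum_(a <- s) a)]].

(* Only the values M n for n >= 1 are used. *)
Definition M_conditions (M : nat -> nat) : Prop :=
  M 1%N = 2%N /\ forall i j, (1 <= i < j)%N -> (M i < M j)%N.

Definition sigma_image (H : set (c00 R)) (sigma : seq (c00 R) -> nat) : set nat :=
  sigma @` blocks H.

(* Since I is an interval and a_1 < ... < a_n, {i | I a_i != 0} is always an
   interval [j1, j2], and (I a_{j1}, ..., I a_{j2}) lists the nonzero I a_i. *)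
Definition sigma1 (H : set (c00 R)) (sigma : seq (c00 R) -> nat) : Prop :=
  forall s I, blocks H s -> interval_of_nat I ->
    let t := [seq y <- [seq restr I a | a <- s] | y != 0] in
    t <> [::] -> (sigma t <= sigma s)%N.

Definition sigma2 (H : set (c00 R)) (sigma : seq (c00 R) -> nat) : Prop :=
  forall s a, blocks H (rcons s a) ->
    forall i, supp a i -> (i < sigma (rcons s a))%N.

Definition sigma3 (H : set (c00 R)) (sigma : seq (c00 R) -> nat) : Prop :=
  (\esum_(n in sigma_image H sigma) ((logf n%:R)^-1)%:E < +oo)%E.

Definition consecutive_in (S : set nat) (p q : nat) : Prop :=
  [/\ S p, S q, (p < q)%N & forall k, S k -> ~ (p < k < q)%N].

Definition sigma4_quantity (m l : nat) : R :=
  2 * (logf m%:R / m%:R + 1 / logf l%:R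
       + logf m%:R / m%:R * ((minn l m)%:R / logf l%:R)).

Definition sigma4 (H : set (c00 R)) (sigma : seq (c00 R) -> nat) : Prop :=
  forall p m q, consecutive_in (sigma_image H sigma) p m ->
    consecutive_in (sigma_image H sigma) m q ->
  forall l, (1 <= l <= p)%N \/ (q <= l)%N ->
    ((l < m)%N -> sigma4_quantity m l <= 3 / logf l%:R) /\
    ((m < l)%N -> sigma4_quantity m l <= 3 * logf m%:R / m%:R).

(* sigma maps into the positive integers by sigma2. *)
Definition sigma_conditions (H : set (c00 R)) (sigma : seq (c00 R) -> nat) : Prop :=
  [/\ set_inj (blocks H) sigma,
      sigma1 H sigma, sigma2 H sigma, sigma3 H sigma & sigma4 H sigma].

Definition admissible (M : nat -> nat) (sigma : seq (c00 R) -> nat)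
    (D : nat -> set (c00 R)) (s : seq (c00 R)) : Prop :=
  [/\ s <> [::], sorted (@c00_lt R) s,
      exists2 i, (M (size s) <= i)%N & D i (nth 0 s 0) &
      forall i, (i.+1 < size s)%N -> D (sigma (take i.+1 s)) (nth 0 s i.+1)].

(* The indices i at which admissibility looks up a set D_i satisfy i >= M 1 = 2
   or i > max supp >= 1, so [AXm], [tilde_A] and [BXm] matter for m >= 2 only. *)
Definition AXm (H : set (c00 R)) (N : c00 R -> R) (m : nat) : set (c00 R) :=
  [set m%:R^-1 *: \sum_(a <- s) a | s in
    [set s | [/\ size s = m, sorted (@c00_lt R) s &
                 forall a, a \in s -> (H `&` dual_ball N) a]]].

Definition AX (H : set (c00 R)) (N : c00 R -> R) : set (c00 R) :=
  \bigcup_(m in [set m | (2 <= m)%N]) AXm H N m.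

Definition tilde_A (H : set (c00 R)) (N : c00 R -> R) (m : nat) : set (c00 R) :=
  \bigcup_(n in [set n | (m <= n)%N]) AXm H N n.

Definition BXm (H : set (c00 R)) (M : nat -> nat) (sigma : seq (c00 R) -> nat)
    (N : c00 R -> R) (m : nat) : set (c00 R) :=
  [set (logf m%:R)^-1 *: \sum_(a <- s) a | s in
    [set s | [/\ size s = m, forall a, a \in s -> AX H N a &
                 admissible M sigma (tilde_A H N) s]]].

Definition BX (H : set (c00 R)) (M : nat -> nat) (sigma : seq (c00 R) -> nat)
    (N : c00 R -> R) : set (c00 R) :=
  \bigcup_(m in [set m | (2 <= m)%N]) BXm H M sigma N m.

Definition CXm (H : set (c00 R)) (M : nat -> nat) (sigma : seq (c00 R) -> nat)
    (N : c00 R -> R) (m : nat) : set (c00 R) :=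
  [set (logf m%:R)^-1 *: \sum_(a <- s) a | s in
    [set s | [/\ size s = m, forall a, a \in s -> BX H M sigma N a &
                 admissible M sigma (BXm H M sigma N) s]]].

Definition CX (H : set (c00 R)) (M : nat -> nat) (sigma : seq (c00 R) -> nat)
    (N : c00 R -> R) : set (c00 R) :=
  \bigcup_(m in [set m | (1 <= m)%N]) CXm H M sigma N m.

End Construction.

(* Main.v *)
Require Import Defs.
From HB Require Import structures.
From mathcomp Require Import all_boot all_order all_algebra.
From mathcomp Require Import all_classical all_reals all_analysis.
From mathcomp Require Import ring lra.
Import Order.TTheory GRing.Theory Num.Theory.
Import numFieldNormedType.Exports.
Set Implicit Arguments.
Unset Strict Implicit.
Unset Printing Implicit Defensive.
Local Open Scope classical_set_scope.
Local Open Scope ring_scope.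

(** The norm is given by a norming set [W] of finitely supported functionals with
    [W = {e_i^*} u C^X], where [X] carries the norm induced by [W].  Such a [W] exists
    by the Knaster-Tarski theorem, since a larger norm has a larger dual ball and
    hence larger sets A, B, C.  The basis is monotone because the truncation of an
    element of [C^X] to an initial segment is completed to an element of [C^X] by
    replacing its tail with far away vectors, which a given vector does not see.

    Boundedly complete: if the partial sums of a bounded sequence are not Cauchy,
    some element of [B_n^X], a subset of [C_1^X], has value at least
    [delta n / (8 f(n))] on it, which is unbounded in [n].

    Shrinking: call a class of functionals small if every convex subset of the
    unit ball with elements supported arbitrarily far out contains a vector on
    which the class is at most [1/2 + e].  Halves of elements of the dual ball form
    a small class, and smallness passes to sums of successive functionals with
    weights tending to [0]; so A, B, C, and then [W], are small.  A functional that is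
    at least [t] on unit vectors arbitrarily far out is then at least [4 t / 3] on
    other such vectors, and iterating contradicts its boundedness. *)

(** * Pairing of finitely supported functionals with arbitrary sequences *)

Section Sequences.
Variable R : realType.
Implicit Types (a b x : c00 R) (y z : nat -> R^o).

Definition below k y := forall i, (k <= i)%N -> y i = 0.
Definition beyond k y := forall i, (i < k)%N -> y i = 0.

Lemma c00E a b : (a =1 b :> (nat -> R^o)) -> a = b.
Proof. by move=> ab; apply/val_inj/funext. Qed.

Lemma c00_at0 a : a 0%N = 0.
Proof. by have /c00_predP[] := c00_valP a. Qed.

Lemma c00D a b i : (a + b) i = a i + b i. Proof. by []. Qed.
Lemma c00Z (c : R) a i : (c *: a) i = c * a i. Proof. by []. Qed.
Lemma c00N a i : (- a) i = - a i. Proof. by []. Qed.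
Lemma c00_0 i : (0 : c00 R) i = 0. Proof. by []. Qed.

Lemma c00_below a : exists k, below k a.
Proof.
have /c00_predP[_ fa] := c00_valP a.
have [M aM] : exists M, forall i, a i != 0 -> (i <= M)%N.
  have /finite_seqP[s sE] := fa.
  exists (\max_(j <- s) j) => i ai.
  have si : i \in s by have : [set` s] i by rewrite -sE.
  by apply: (@leq_bigmax_seq _ s xpredT (fun j => j) i si).
exists M.+1 => i Mi; apply/eqP; apply: contraLR Mi => /aM.
by rewrite -leqNgt.
Qed.

Lemma belowW k l y : (k <= l)%N -> below k y -> below l y.
Proof. by move=> kl yk i li; apply: yk; apply: leq_trans li. Qed.

Lemma beyondW k l y : (l <= k)%N -> beyond k y -> beyond l y.
Proof. by move=> kl yk i li; apply: yk; apply: leq_trans li kl. Qed.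

(** The same sum as [pairing], but with an arbitrary sequence on the right: elements of the
    completion will be realised as sequences, and the finite support of [a] makes the sum finite. *)
Definition dot a y : R := \sum_(i \in [set: nat]) a i * y i.

Lemma dotE k a y : below k a -> dot a y = \sum_(i < k) a i * y i.
Proof.
move=> ak; rewrite (fsbig_ord _ _ (fun i : nat => a i * y i)).
apply/esym/fsbig_widen => // i [_] /= /negP.
by rewrite -leqNgt => ki; rewrite ak ?mul0r.
Qed.

Lemma dotEr k a y : below k y -> dot a y = \sum_(i < k) a i * y i.
Proof.
move=> ak; rewrite (fsbig_ord _ _ (fun i : nat => a i * y i)).
apply/esym/fsbig_widen => // i [_] /= /negP.
by rewrite -leqNgt => ki; rewrite ak ?mulr0.
Qed.

Lemma dotDr a y z : dot a (y + z) = dot a y + dot a z.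
Proof.
have [k ak] := c00_below a; rewrite !(dotE _ ak) -big_split /=.
by apply: eq_bigr => i _; rewrite -mulrDr.
Qed.

Lemma dotZr a (c : R) y : dot a (c *: y) = c * dot a y.
Proof.
have [k ak] := c00_below a; rewrite !(dotE _ ak) mulr_sumr /=.
by apply: eq_bigr => i _; rewrite mulrCA.
Qed.

Lemma dotNr a y : dot a (- y) = - dot a y.
Proof. by rewrite -scaleN1r dotZr mulN1r. Qed.

Lemma dotBr a y z : dot a (y - z) = dot a y - dot a z.
Proof. by rewrite dotDr dotNr. Qed.

Lemma dot0r a : dot a 0 = 0.
Proof. by rewrite -(scale0r (0 : nat -> R^o)) dotZr mul0r. Qed.

Lemma dotDl a b y : dot (a + b) y = dot a y + dot b y.
Proof.
have [k ak] := c00_below a; have [l bl] := c00_below b.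
have ak' := belowW (leq_maxl k l) ak; have bl' := belowW (leq_maxr k l) bl.
rewrite (dotE _ ak') (dotE _ bl') (@dotE (maxn k l)).
  by rewrite -big_split /=; apply: eq_bigr => i _; rewrite -mulrDl.
by move=> i mi; rewrite c00D ak' // bl' // addr0.
Qed.

Lemma dotZl (c : R) a y : dot (c *: a) y = c * dot a y.
Proof.
have [k ak] := c00_below a.
rewrite (dotE _ ak) (@dotE k).
  by rewrite mulr_sumr; apply: eq_bigr => i _; rewrite mulrA.
by move=> i mi; rewrite c00Z ak // mulr0.
Qed.

Lemma dot0l y : dot 0 y = 0.
Proof. by rewrite -(scale0r (0 : c00 R)) dotZl mul0r. Qed.

Lemma dotNl a y : dot (- a) y = - dot a y.
Proof. by rewrite -scaleN1r dotZl mulN1r. Qed.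

Lemma dotBl a b y : dot (a - b) y = dot a y - dot b y.
Proof. by rewrite dotDl dotNl. Qed.

Lemma dot_suml (I : Type) (s : seq I) (F : I -> c00 R) y :
  dot (\sum_(i <- s) F i) y = \sum_(i <- s) dot (F i) y.
Proof.
elim: s => [|i s IH]; first by rewrite !big_nil dot0l.
by rewrite !big_cons dotDl IH.
Qed.

Lemma pairing_dot a x : pairing a x = dot a x. Proof. by []. Qed.

Lemma pairingC a x : pairing a x = pairing x a.
Proof. by apply: eq_fsbigr => i _; rewrite mulrC. Qed.

Lemma pairingDr a x x' : pairing a (x + x') = pairing a x + pairing a x'.
Proof. exact: dotDr. Qed.

Lemma pairingZr a (c : R) x : pairing a (c *: x) = c * pairing a x.
Proof. exact: dotZr. Qed.

Lemma pairing0r a : pairing a 0 = 0.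
Proof. exact: dot0r. Qed.

Lemma dot_unitv i y : dot (unitv R i) y = y i.+1.
Proof.
rewrite (@dotE i.+2); last first.
  by move=> j ij /=; rewrite (gtn_eqF ij).
rewrite big_ord_recr /= eqxx mul1r big1 ?add0r // => j _.
by rewrite (ltn_eqF (ltn_ord j)) mul0r.
Qed.

Lemma eq_dot k a y z : below k a ->
  (forall i, (0 < i < k)%N -> y i = z i) -> dot a y = dot a z.
Proof.
move=> ak yz; rewrite !(dotE _ ak); apply: eq_bigr => i _.
have [i0|i0] := posnP i; last by rewrite yz // i0 /=.
by rewrite i0 c00_at0 !mul0r.
Qed.

Lemma dot_disjoint k a y : below k a -> beyond k y -> dot a y = 0.
Proof.
by move=> ak yk; rewrite (dotE _ ak) big1 // => i _; rewrite yk // mulr0.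
Qed.

Lemma dot_disjointr k a y : beyond k a -> below k y -> dot a y = 0.
Proof.
by move=> ak yk; rewrite (dotEr _ yk) big1 // => i _; rewrite ak // mul0r.
Qed.

(** The guard [0 < i] is there because the truncated sequence is arbitrary, whereas elements of
    [c00] vanish at [0]. *)
Fact trunc_subproof k y :
  (fun i => if (0 < i < k)%N then y i else 0 : R^o) \in @c00_pred R.
Proof.
apply/c00_predP; split=> //; apply: (sub_finite_set _ (finite_II k)) => i /=.
by case: ifP => [/andP[]//|]; rewrite eqxx.
Qed.

Definition trunc k y : c00 R := C00 (trunc_subproof k y).

Lemma trunc_seqE k x i : trunc k x i = if (i < k)%N then x i else 0.
Proof. by rewrite /=; case: i => [|i] //=; rewrite c00_at0 if_same. Qed.

Lemma trunc_restr k x : trunc k x = restr `I_k x.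
Proof.
apply: c00E => i; rewrite trunc_seqE /=.
by have -> : (i \in `I_k) = (i < k)%N by apply/idP/idP; rewrite inE.
Qed.

Lemma trunc_id k x : below k x -> trunc k x = x.
Proof.
by move=> xk; apply: c00E => i; rewrite trunc_seqE; case: ltnP => // /xk ->.
Qed.

Lemma below_trunc k y : below k (trunc k y).
Proof. by move=> i ki /=; rewrite [(i < k)%N]ltnNge ki andbF. Qed.

Lemma trunc_seqD k y z : trunc k (y + z) = trunc k y + trunc k z.
Proof. by apply: c00E => i; rewrite c00D /=; case: ifP => // _; rewrite addr0. Qed.

Lemma trunc_seqZ k (c : R) y : trunc k (c *: y) = c *: trunc k y.
Proof. by apply: c00E => i; rewrite c00Z /=; case: ifP => // _; rewrite mulr0. Qed.

Lemma trunc_seqN k y : trunc k (- y) = - trunc k y.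
Proof. by rewrite -[- y]scaleN1r trunc_seqZ scaleN1r. Qed.

Lemma dot_trunc k a y : dot (trunc k a) y = dot a (trunc k y).
Proof.
have [l al] := c00_below a.
rewrite (@dotE (maxn k l)); last by apply: belowW (leq_maxl _ _) (@below_trunc _ _).
rewrite (@dotE (maxn k l)); last exact: belowW (leq_maxr _ _) al.
apply: eq_bigr => i _ /=; case: ifP => _ //; by rewrite mulr0 mul0r.
Qed.

Lemma dot_truncr k a y : below k a -> dot a (trunc k y) = dot a y.
Proof. by move=> ak; rewrite -dot_trunc trunc_id. Qed.

Lemma trunc_trunc k l y : (k <= l)%N -> trunc k (trunc l y) = trunc k y.
Proof.
move=> kl; apply: c00E => i /=; case: andP => // -[i0 ik].
by rewrite i0 (leq_trans ik kl).
Qed.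

Lemma l1_normE k x : below k x -> l1_norm x = \sum_(i < k) `|x i|.
Proof.
move=> ak; rewrite (fsbig_ord _ _ (fun i : nat => `|x i|)).
apply/esym/fsbig_widen => // i [_] /= /negP.
by rewrite -leqNgt => ki; rewrite ak ?normr0.
Qed.

Lemma l1_norm_ge0 x : 0 <= l1_norm x.
Proof.
by have [k xk] := c00_below x; rewrite (l1_normE xk) sumr_ge0.
Qed.

Lemma dot_le_l1 (c : R) a y : (forall i, `|y i| <= c) ->
  `|dot a y| <= c * l1_norm a.
Proof.
move=> yc; have [k ak] := c00_below a.
rewrite (l1_normE ak) (dotE _ ak) (le_trans (ler_norm_sum _ _ _)) //.
by rewrite mulr_sumr ler_sum // => i _; rewrite normrM mulrC ler_wpM2r.
Qed.

Lemma coord_le_l1 x i : `|x i| <= l1_norm x.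
Proof.
have [k xk] := c00_below x; rewrite (l1_normE xk).
have [ki|ik] := leqP k i; first by rewrite xk // normr0 sumr_ge0.
by rewrite (bigD1 (Ordinal ik)) //= lerDl sumr_ge0.
Qed.

Lemma pairing_le_l1 (c : R) a x : (forall i, `|a i| <= c) ->
  `|pairing a x| <= c * l1_norm x.
Proof. by move=> ac; rewrite pairingC; apply: dot_le_l1. Qed.

End Sequences.

(** * Norms induced by norming sets of functionals *)

Section NormingSets.
Variable R : realType.

(** The unit functionals make the induced [nrm] dominate every coordinate, hence separate points;
    the bound on coordinates keeps it below the [l1] norm, hence finite on [c00]. *)
Record normset := NormSet {
  ns_set :> set (c00 R);
  ns_unitv : forall i, ns_set (unitv R i);
  ns_coord : forall w, ns_set w -> forall i, `|w i| <= 1 }.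

(** The real [sup] returns a default value on unbounded sets, so statements about arbitrary
    sequences carry the assumption [nrm_bounded]. *)
Definition nrm (W : set (c00 R)) (y : nat -> R^o) : R :=
  sup [set `|dot w y| | w in W].

Definition nrm_bounded (W : set (c00 R)) (y : nat -> R^o) :=
  exists S, forall w, W w -> `|dot w y| <= S.

Implicit Types (W : normset) (y : nat -> R^o) (x : c00 R).

Lemma dot_le_nrm (W : set (c00 R)) y w :
  nrm_bounded W y -> W w -> `|dot w y| <= nrm W y.
Proof.
move=> [S WS] Ww; apply: ub_le_sup; last by exists w.
by exists S => _ [v Wv <-]; apply: WS.
Qed.

Lemma nrm_le W y S : (forall w, ns_set W w -> `|dot w y| <= S) -> nrm W y <= S.
Proof.
move=> WS; apply: ge_sup => [|_ [w Ww <-]]; last exact: WS.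
by exists `|dot (unitv R 0) y|, (unitv R 0) => //; apply: ns_unitv.
Qed.

Lemma nrm_bounded_c00 W x : nrm_bounded W x.
Proof.
exists (1 * l1_norm x) => w Ww.
exact: pairing_le_l1 (ns_coord Ww).
Qed.

Lemma pairing_le_nrm W w x : ns_set W w -> `|pairing w x| <= nrm W x.
Proof. exact: dot_le_nrm (nrm_bounded_c00 W x). Qed.

Lemma coord_le_nrm W y i : nrm_bounded W y -> `|y i.+1| <= nrm W y.
Proof.
by move=> yW; rewrite -dot_unitv; apply: dot_le_nrm => //; apply: ns_unitv.
Qed.

Lemma nrm_ge0 W y : nrm_bounded W y -> 0 <= nrm W y.
Proof. by move=> /(coord_le_nrm 0); apply: le_trans. Qed.

Lemma nrm_gt W y e : e < nrm W y -> exists2 w, ns_set W w & e < `|dot w y|.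
Proof.
move=> ey; apply: contrapT => /forall2NP nW; move: ey; rewrite ltNge.
rewrite nrm_le // => w Ww; have [//|] := nW w.
by move/negP; rewrite -leNgt.
Qed.

Lemma nrmD W y z : nrm_bounded W y -> nrm_bounded W z ->
  nrm W (y + z) <= nrm W y + nrm W z.
Proof.
move=> yW zW; apply: nrm_le => w Ww; rewrite dotDr.
by rewrite (le_trans (ler_normD _ _)) // lerD // dot_le_nrm.
Qed.

Lemma nrm_boundedZ (W : set (c00 R)) (c : R) y :
  nrm_bounded W y -> nrm_bounded W (c *: y).
Proof.
move=> [S yS]; exists (`|c| * S) => w Ww.
by rewrite dotZr normrM ler_wpM2l // yS.
Qed.

Lemma nrm_boundedD (W : set (c00 R)) y z :
  nrm_bounded W y -> nrm_bounded W z -> nrm_bounded W (y + z).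
Proof.
move=> [S yS] [T zT]; exists (S + T) => w Ww.
by rewrite dotDr (le_trans (ler_normD _ _)) // lerD // (yS, zT).
Qed.

Lemma nrmZ W (c : R) y : nrm_bounded W y -> nrm W (c *: y) = `|c| * nrm W y.
Proof.
have le d z : nrm_bounded W z -> nrm W (d *: z) <= `|d| * nrm W z.
  move=> zW; apply: nrm_le => w Ww.
  by rewrite dotZr normrM ler_wpM2l // dot_le_nrm.
move=> yW; apply/eqP; rewrite eq_le le //=.
have [->|c0] := eqVneq c 0.
  by rewrite normr0 mul0r nrm_ge0 //; apply: nrm_boundedZ.
rewrite -ler_pdivlMl ?normr_gt0 // -normfV.
rewrite -[X in nrm W X](scale1r y) -(mulVf c0) -scalerA le //.
exact: nrm_boundedZ.
Qed.

Lemma nrmN W y : nrm W (- y) = nrm W y.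
Proof.
by congr sup; apply/seteqP; split=> _ [w Ww <-]; exists w => //; rewrite dotNr normrN.
Qed.

Lemma nrm_c00D W (x x' : c00 R) : nrm W (x + x') <= nrm W x + nrm W x'.
Proof. by apply: (@nrmD W x x'); apply: nrm_bounded_c00. Qed.

Lemma nrm_c00Z W (c : R) x : nrm W (c *: x) = `|c| * nrm W x.
Proof. by apply: (@nrmZ W c x); apply: nrm_bounded_c00. Qed.

Lemma nrm_c00N W x : nrm W (- x) = nrm W x.
Proof. exact: (@nrmN W x). Qed.

Lemma is_norm_nrm W : is_norm (fun x => nrm W x).
Proof.
split; [exact: nrm_c00D | exact: nrm_c00Z |] => x x0.
apply: c00E => -[|i]; first exact: c00_at0.
apply/normr0_eq0/le_anti; rewrite normr_ge0 andbT -[leRHS]x0.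
exact/coord_le_nrm/nrm_bounded_c00.
Qed.

Lemma dual_ballP W a :
  dual_ball (fun x => nrm W x) a <-> forall x, `|pairing a x| <= nrm W x.
Proof.
split=> [aB x | aB].
  have [x0|x0] := eqVneq (nrm W x) 0.
    have [_ _ /(_ x x0) ->] := is_norm_nrm W.
    by rewrite pairing0r normr0 (nrm_ge0 (nrm_bounded_c00 W 0)).
  have x_gt0 : 0 < nrm W x by rewrite lt0r x0 nrm_ge0 //; apply: nrm_bounded_c00.
  have : (`|pairing a ((nrm W x)^-1 *: x)|%:E <= 1)%E.
    apply: le_trans aB; apply: ereal_sup_ubound; exists ((nrm W x)^-1 *: x) => //=.
    by rewrite nrm_c00Z normfV (gtr0_norm x_gt0) mulVf.
  by rewrite lee_fin pairingZr normrM normfV (gtr0_norm x_gt0) ler_pdivrMl // mulr1.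
by apply: ub_ereal_sup => _ [x x1 <-]; rewrite lee_fin (le_trans (aB x)).
Qed.

Lemma subset_nrm (W W' : normset) y : nrm_bounded W' y -> W `<=` W' ->
  nrm W y <= nrm W' y.
Proof. by move=> yW WW; apply: nrm_le => w /WW; apply: dot_le_nrm. Qed.

Lemma unitv_in_dual_ball W i : dual_ball (fun x => nrm W x) (unitv R i).
Proof. by apply/dual_ballP => x; apply: pairing_le_nrm; apply: ns_unitv. Qed.

End NormingSets.

(** * Successive finitely supported functionals *)

Section Blocks.
Variable R : realType.
Implicit Types (a b : c00 R) (s : seq (c00 R)).

Lemma c00_last a : a != 0 -> exists2 k, a k != 0 & below k.+1 a.
Proof.
move=> a0; have [k ak] := c00_below a; elim: k ak => [|k IH] ak.
  by move: a0; rewrite (_ : a = 0) ?eqxx //; apply: c00E => i; apply: ak.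
have [ak0|ak0] := eqVneq (a k) 0; last by exists k.
apply: IH => i; rewrite leq_eqVlt => /predU1P[<-//|]; exact: ak.
Qed.

Lemma c00_ltP a b :
  reflect [/\ a != 0, b != 0 & exists k, below k a /\ beyond k b] (c00_lt a b).
Proof.
apply: (iffP and3P) => -[a0 b0].
  move=> /asboolP ab; split=> //; have [k ak ka] := c00_last a0.
  exists k.+1; split=> // i; rewrite ltnS => ik; apply: contrapT => /eqP bi.
  by have := ab _ _ ak bi; rewrite ltnNge ik.
move=> [k [ak bk]]; split=> //; apply/asboolP => i j ai bj.
have ik : (i < k)%N.
  by rewrite ltnNge; apply: contraNN ai => /ak ->.
by apply: (leq_trans ik); rewrite leqNgt; apply: contraNN bj => /bk ->.
Qed.

Lemma c00_lt_trans : transitive (@c00_lt R).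
Proof.
move=> b a c /c00_ltP[a0 b0 [k [ak bk]]] /c00_ltP[_ c0 [l [bl cl]]].
apply/c00_ltP; split=> //; exists k; split=> // i ik; apply: cl.
apply: contrapT => /negP; rewrite -leqNgt => li.
move: b0; rewrite (_ : b = 0) ?eqxx //; apply: c00E => j.
have [jk|kj] := ltnP j k; first exact: bk.
by apply: bl; apply: leq_trans li (leq_trans (ltnW ik) kj).
Qed.

Lemma sorted_cons_split a s : sorted (@c00_lt R) (a :: s) ->
  exists k, below k a /\ forall b, b \in s -> beyond k b.
Proof.
move=> /(order_path_min c00_lt_trans)/allP/= as_.
(* A one-term list is sorted even when its term is [0], which has no last coordinate. *)
have [->|a0] := eqVneq a 0.
  exists 0%N; split; first by move=> i _; rewrite c00_0.
  by move=> b _ i.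
have [k ak ka] := c00_last a0; exists k.+1; split=> // b /as_ /c00_ltP[_ _ [l [al bl]]].
apply: beyondW bl; rewrite ltnNge; apply: contraNN ak => lk.
by rewrite al.
Qed.

Lemma sum_coord s i : (\sum_(a <- s) a) i = \sum_(a <- s) a i.
Proof.
by elim: s => [|a s IH]; rewrite ?big_nil ?c00_0 // !big_cons c00D IH.
Qed.

Lemma below_sum s k : (forall a, a \in s -> below k a) -> below k (\sum_(a <- s) a).
Proof. by move=> sk i ki; rewrite sum_coord big1_seq // => a /andP[_ /sk]; apply. Qed.

Lemma beyond_sum s k : (forall a, a \in s -> beyond k a) -> beyond k (\sum_(a <- s) a).
Proof. by move=> sk i ki; rewrite sum_coord big1_seq // => a /andP[_ /sk]; apply. Qed.

(** The supports are disjoint, so each coordinate of the sum comes from at most one term. *)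
Lemma sorted_coord_le s (e : R) : 0 <= e -> sorted (@c00_lt R) s ->
  (forall a, a \in s -> forall i, `|a i| <= e) ->
  forall i, `|(\sum_(a <- s) a) i| <= e.
Proof.
move=> e0; elim: s => [|a s IH] ss se i; first by rewrite big_nil c00_0 normr0.
rewrite big_cons c00D; have [k [ak sk]] := sorted_cons_split ss.
have [ik|ki] := ltnP i k.
  by rewrite (beyond_sum sk) // addr0 se // mem_head.
rewrite ak // add0r IH //; first exact: path_sorted ss.
by move=> b bs; apply: se; rewrite inE bs orbT.
Qed.

End Blocks.

(** * Small classes of functionals *)

Section Shrinking.
Variables (R : realType) (W : normset R).
Implicit Types (a b c d x y : c00 R) (G D : set (c00 R)) (theta e : R)
  (s : seq (c00 R)).

Definition convexc G :=
  forall (t : R) x y, 0 <= t <= 1 -> G x -> G y -> G (t *: x + (1 - t) *: y).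

Definition cofinal G := forall k, exists2 x, G x & beyond k x.

Definition functionals_bounded D :=
  exists K, forall c, D c -> forall x, `|pairing c x| <= K * nrm W x.

(** Used with [theta = 1/2]. The uniform bound is what lets an occasional large value disappear in
    an average, see [small_mean]. *)
Definition small (theta : R) D := functionals_bounded D /\
  forall e G, 0 < e -> convexc G -> cofinal G -> (forall x, G x -> nrm W x <= 1) ->
  exists2 x, G x & forall c, D c -> `|pairing c x| <= theta + e.

Lemma convex_mean G s : convexc G -> s <> [::] -> (forall x, x \in s -> G x) ->
  G ((size s)%:R^-1 *: \sum_(x <- s) x).
Proof.
move=> Gc; elim: s => [//|x [|y s] IH] _ sG.
  by rewrite big_cons big_nil addr0 invr1 scale1r; apply: sG; rewrite mem_head.
have n0 : (size (y :: s))%:R != 0 :> R by rewrite pnatr_eq0.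
have n0' : (size (x :: y :: s))%:R != 0 :> R by rewrite pnatr_eq0.
set q : R := (size (x :: y :: s))%:R^-1.
have t01 : 0 <= q <= 1.
  by rewrite invr_ge0 ler0n /= invf_le1 ?ler1n // ltr0n.
have := Gc q x ((size (y :: s))%:R^-1 *: \sum_(x <- y :: s) x) t01 (sG _ (mem_head _ _)).
move=> H.
rewrite big_cons scalerDr.
suff -> : q *: \sum_(j <- y :: s) j =
   (1 - q) *: ((size (y :: s))%:R^-1 *: \sum_(x <- y :: s) x).
  by apply: H; apply: IH => // z zs; apply: sG; rewrite inE zs orbT.
rewrite scalerA; congr (_ *: _); rewrite /q.
rewrite [size (x :: _)]/= -natr1 in n0' *.
by rewrite [size (_ :: _)]/= in n0 n0' *; field; apply/andP.
Qed.

Lemma convex_beyond G k : convexc G -> convexc [set x | G x /\ beyond k x].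
Proof.
move=> Gc t x y t01 [Gx xk] [Gy yk]; split; first exact: Gc.
by move=> i ik; rewrite c00D !c00Z xk // yk // !mulr0 addr0.
Qed.

Lemma cofinal_beyond G k : cofinal G -> cofinal [set x | G x /\ beyond k x].
Proof.
move=> Gc l; have [x Gx xkl] := Gc (maxn k l).
exists x; last exact: beyondW (leq_maxr _ _) xkl.
by split=> //; exact: beyondW (leq_maxl _ _) xkl.
Qed.

Lemma small_beyond theta D e G k : small theta D -> 0 < e -> convexc G ->
  cofinal G -> (forall x, G x -> nrm W x <= 1) ->
  exists2 x, G x /\ beyond k x & forall c, D c -> `|pairing c x| <= theta + e.
Proof.
move=> [_ sD] e0 Gc Gf G1; apply: sD => //.
- exact: convex_beyond.
- exact: cofinal_beyond.
- by move=> x [/G1].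
Qed.

Lemma convex_good G D (e : R) : convexc G ->
  convexc [set x | G x /\ forall c, D c -> `|pairing c x| <= e].
Proof.
move=> Gc t x y t01 [Gx xe] [Gy ye]; split; first exact: Gc.
move=> c Dc; rewrite pairingDr !pairingZr (le_trans (ler_normD _ _)) // !normrM.
have /andP[t0 t1] := t01; have t1' : 0 <= 1 - t by rewrite subr_ge0.
rewrite (ger0_norm t0) (ger0_norm t1').
have := ler_wpM2l t0 (xe c Dc); have := ler_wpM2l t1' (ye c Dc); lra.
Qed.

Lemma small_sub theta D D' : D `<=` D' -> small theta D' -> small theta D.
Proof.
move=> DD [[K D'K] sD]; split; first by exists K => c /DD; apply: D'K.
move=> e G e0 Gc Gf G1; have [x Gx xe] := sD e G e0 Gc Gf G1.
by exists x => // c /DD; apply: xe.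
Qed.

Lemma small_cofinal theta D e G : small theta D -> 0 < e -> convexc G ->
  cofinal G -> (forall x, G x -> nrm W x <= 1) ->
  cofinal [set x | G x /\ forall c, D c -> `|pairing c x| <= theta + e].
Proof.
move=> sD e0 Gc Gf G1 k; have [x [Gx xk] xe] := small_beyond k sD e0 Gc Gf G1.
by exists x.
Qed.

Lemma functionals_boundedU D D' :
  functionals_bounded D -> functionals_bounded D' -> functionals_bounded (D `|` D').
Proof.
move=> [K DK] [K' DK']; exists (Num.max K K') => c [Dc|Dc] x.
  by rewrite (le_trans (DK _ Dc x)) // ler_wpM2r ?le_max ?lexx // nrm_ge0 //; apply: nrm_bounded_c00.
by rewrite (le_trans (DK' _ Dc x)) // ler_wpM2r ?le_max ?lexx ?orbT // nrm_ge0 //; apply: nrm_bounded_c00.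
Qed.

(** The vectors of [G] on which [D] is small again form a convex cofinal set, to which the smallness
    of [D'] applies. *)
Lemma smallU theta D D' : small theta D -> small theta D' -> small theta (D `|` D').
Proof.
move=> sD sD'; split; first exact: functionals_boundedU sD.1 sD'.1.
move=> e G e0 Gc Gf G1.
have [|||x [Gx xD] xD'] := sD'.2 e [set x | G x /\ forall c, D c -> `|pairing c x| <= theta + e] e0.
- exact: convex_good.
- exact: small_cofinal.
- by move=> x [/G1].
- by exists x => // c [/xD|/xD'].
Qed.

Lemma small0 theta : small theta set0.
Proof.
split; first by exists 0.
by move=> e G _ _ /(_ 0%N)[x Gx _] _; exists x.
Qed.

(** The vectors are chosen one after another so that each functional of [D] exceeds [theta + e / 2]
    on at most one of them. In the mean of many vectors this single large value is diluted. *)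
Lemma small_mean theta D : 0 <= theta -> functionals_bounded D ->
  (forall e G, 0 < e -> convexc G -> cofinal G -> (forall x, G x -> nrm W x <= 1) ->
    exists G', [/\ convexc G', G' `<=` G &
      forall s, (forall x, x \in s -> G' x) -> exists2 y, G' y & forall c, D c ->
       (exists2 x, x \in s & theta + e < `|pairing c x|) -> `|pairing c y| <= theta + e]) ->
  small theta D.
Proof.
move=> th0 DK HD; split=> // e G e0 Gc Gf G1; have [K KD] := DK.
have e20 : 0 < e / 2 by rewrite divr_gt0.
have [G' [G'c G'G HG']] := HD _ _ e20 Gc Gf G1; set th := theta + e / 2 in HG'.
(* A large value is at most [|K|]; divided by [n + 1] it costs at most [e / 2]. *)
have [n Kn] : exists n : nat, `|K| <= n.+1%:R * (e / 2).
  exists (Num.truncn (`|K| / (e / 2))); rewrite -ler_pdivrMr // ltW //.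
  exact: truncnS_gt.
have [s [sz sG' sD]] : exists s : seq (c00 R), [/\ size s = n.+1,
    forall x, x \in s -> G' x & forall c, D c ->
     `|pairing c (\sum_(x <- s) x)| <= (size s)%:R * th + `|K|].
  (* The induction also records the bound without the excess [|K|], valid for functionals that have
     not been large on any vector so far. *)
  suff H m : exists s : seq (c00 R), [/\ size s = m,
    forall x, x \in s -> G' x & forall c, D c ->
     `|pairing c (\sum_(x <- s) x)| <= (size s)%:R * th + `|K| /\
     ((forall x, x \in s -> `|pairing c x| <= th) ->
       `|pairing c (\sum_(x <- s) x)| <= (size s)%:R * th)].
    by have [s [? ? sD]] := H n.+1; exists s; split=> // c Dc; have [] := sD c Dc.
  have th1 : 0 <= th by rewrite addr_ge0 // ltW.
  elim: m => [|m [s [sz sG' sD]]].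
    by exists [::]; split=> // c _; rewrite big_nil pairing0r normr0 mul0r add0r.
  have [y G'y yD] := HG' s sG'; exists (rcons s y).
  rewrite size_rcons sz; split=> //.
    by move=> x; rewrite mem_rcons inE => /predU1P[->|/sG'].
  move=> c Dc; rewrite -cats1 big_cat big_seq1 /= pairingDr.
  have [sDc1 sDc2] := sD c Dc; rewrite sz in sDc1 sDc2.
  have tri := ler_normD (pairing c (\sum_(x <- s) x)) (pairing c y).
  have cy : `|pairing c y| <= `|K|.
    rewrite (le_trans (KD c Dc y)) //.
    rewrite (@le_trans _ _ (`|K| * nrm W y)) //.
      by rewrite ler_wpM2r ?ler_norm // nrm_ge0 //; apply: nrm_bounded_c00.
    by rewrite ler_piMr // G1 //; apply: G'G.
  rewrite -natr1 mulrDl mul1r.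
  have [all_le|] := pselect (forall x, x \in s -> `|pairing c x| <= th).
    split=> [|ally].
      by have := sDc2 all_le; lra.
    have := ally y; rewrite mem_cat inE eqxx orbT => /(_ isT).
    by have := sDc2 all_le; lra.
  move=> nall; have {}nall : exists2 x, x \in s & th < `|pairing c x|.
    apply: contrapT => /forall2NP nx; apply: nall => x xs; have [//|] := nx x.
    by move/negP; rewrite -leNgt.
  have := yD c Dc nall => yth; split=> [|ally]; first lra.
  have [x xs xth] := nall; have := ally x; rewrite mem_cat xs => /(_ isT); lra.
have sn0 : s <> [::] by move=> s0; rewrite s0 in sz.
exists ((size s)%:R^-1 *: \sum_(x <- s) x); first by apply: G'G; apply: convex_mean.
move=> c Dc; rewrite pairingZr normrM ger0_norm ?invr_ge0 // ler_pdivrMl; last first.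
  by rewrite ltr0n sz.
have := sD c Dc; rewrite sz /th; lra.
Qed.

(** Only functionals already large on some chosen vector constrain the next choice, and for finitely
    many chosen vectors these lie in a finite union of small classes. *)
Lemma small_of_large theta D : 0 <= theta -> functionals_bounded D ->
  (forall u, small theta [set c | D c /\ theta < `|pairing c u|]) -> small theta D.
Proof.
move=> th0 DK sD; apply: small_mean => // e G e0 Gc Gf G1; exists G; split=> // s sG.
have /(_ s)[_ sm] : forall s, small theta
    [set c | D c /\ exists2 x, x \in s & theta < `|pairing c x|].
  elim=> [|x {sG}s IH]; first by apply: small_sub (small0 _) => c [_ []].
  apply: small_sub (smallU (sD x) IH) => c [Dc [y]]; rewrite inE.
  by move=> /predU1P[->|ys] cy; [left|right; split=> //; exists y].
have [y Gy yD] := sm e G e0 Gc Gf G1; exists y => // c Dc [x xs cx].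
by apply: yD; split=> //; exists x => //; lra.
Qed.

(* A functional [d + d'] with [d < d'] can be large on at most one vector of a
   block sequence on which both [d] and [d'] are small. *)
Lemma small_add theta D D' : 0 <= theta -> small theta D -> small theta D' ->
  small theta [set c | exists d d', [/\ D d, D' d', c = d + d' &
                                    exists k, below k d /\ beyond k d']].
Proof.
move=> th0 sD sD'; apply: small_mean => //.
  have [[K DK] _] := sD; have [[K' DK'] _] := sD'; exists (K + K').
  move=> _ [d [e [Dd De -> _]]] x; rewrite pairingC pairingDr -!(pairingC _ x).
  by rewrite (le_trans (ler_normD _ _)) // mulrDl lerD // (DK, DK').
move=> e G e0 Gc Gf G1.
set DD := D `|` D'; have sDD : small theta DD by apply: smallU.
exists [set x | G x /\ forall c, DD c -> `|pairing c x| <= theta + e].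
split; [exact: convex_good | by move=> x [] |] => s sG.
have [l sl] : exists l, forall x, x \in s -> below l x.
  elim: s {sG} => [|x s [l sl]]; first by exists 0%N.
  have [k xk] := c00_below x; exists (maxn k l) => y; rewrite inE.
  move=> /predU1P[->|/sl yl]; first exact: belowW (leq_maxl _ _) xk.
  exact: belowW (leq_maxr _ _) yl.
have [y [Gy yl] yD] := small_beyond l sDD e0 Gc Gf G1.
exists y => // _ [d [d' [Dd Dd' -> [k [dk d'k]]]]] [x xs].
have lin z : pairing (d + d') z = pairing d z + pairing d' z by exact: dotDl.
(* Either [d] ends before [y] begins, so that only [d'] acts on [y], or [d'] begins after every
   vector of [s], so that only [d] acts on [x] and the value there is not large. *)
have [kl|lk] := leqP k l.
  rewrite !lin [pairing d y](dot_disjoint dk (beyondW kl yl)) add0r.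
  by move=> _; apply: yD; right.
rewrite lin [pairing d' x](dot_disjointr d'k (belowW (ltnW lk) (sl _ xs))) addr0.
by rewrite ltNge (sG x xs).2 //; left.
Qed.

Lemma small_sums theta D n : 0 <= theta -> small theta D ->
  small theta [set \sum_(a <- s) a | s in
    [set s | [/\ size s = n, sorted (@c00_lt R) s & forall a, a \in s -> D a]]].
Proof.
move=> th0 sD; have sz : small theta [set 0].
  split; first by exists 0 => _ -> x; rewrite pairingC pairing0r normr0 mul0r.
  move=> e G e0 Gc /(_ 0%N)[x Gx _] G1; exists x => // _ ->.
  by rewrite pairingC pairing0r normr0 addr_ge0 // ltW.
elim: n => [|n IH].
  by apply: small_sub sz => _ [s [/size0nil-> _ _] <-]; rewrite big_nil.
apply: small_sub (small_add th0 sD IH) => _ [[|a s] [sn ss sDs] <-] //.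
case: sn => sn.
have [k [ak sk]] := sorted_cons_split ss.
exists a, (\sum_(b <- s) b); split; first by apply: sDs; rewrite mem_head.
- exists s => //; split=> //; first exact: path_sorted ss.
  by move=> b bs; apply: sDs; rewrite inE bs orbT.
- by rewrite big_cons.
- by exists k; split=> //; apply: beyond_sum.
Qed.

Lemma small_shrink theta D : small theta D ->
  small theta [set c *: d | c in [set c : R | `|c| <= 1] & d in D].
Proof.
move=> [[K DK] sD]; split.
  exists K => _ [c /= c1 [d Dd <-]] x.
  rewrite pairingC pairingZr normrM -pairingC (le_trans _ (DK d Dd x)) //.
  by rewrite ler_piMl.
move=> e G e0 Gc Gf G1; have [x Gx xD] := sD e G e0 Gc Gf G1.
exists x => // _ [c /= c1 [d Dd <-]].
by rewrite pairingC pairingZr normrM -pairingC (le_trans _ (xD d Dd)) // ler_piMl.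
Qed.

Lemma small_bigU theta (F : nat -> set (c00 R)) n :
  (forall i, small theta (F i)) -> small theta [set c | exists2 i, (i < n)%N & F i c].
Proof.
move=> sF; elim: n => [|n IH]; first by apply: small_sub (small0 _) => c [].
apply: small_sub (smallU (sF n) IH) => c [i]; rewrite ltnS leq_eqVlt.
by move=> /predU1P[->|il] Fc; [left|right; exists i].
Qed.

(* The weights tend to [0], so only finitely many lengths can be large on a
   given vector. *)
Lemma small_blocks theta D T (w : nat -> R) : 0 < theta -> small theta D ->
  (forall d, D d -> forall i, `|d i| <= 1) ->
  (forall n, 0 <= w n <= 1) ->
  (forall e, 0 < e -> exists n0, forall n, (n0 <= n)%N -> w n < e) ->
  functionals_bounded T ->
  (forall c, T c -> exists s, [/\ sorted (@c00_lt R) s, forall a, a \in s -> D a &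
     c = w (size s) *: \sum_(a <- s) a]) ->
  small theta T.
Proof.
move=> th0 sD D1 w01 w0 Tb TD; apply: small_of_large => //; first exact: ltW.
(* The coordinates of a sum of blocks are at most [1], so a weight below this quotient gives a value
   at most [theta] on [u]. The [+ 1] avoids a zero denominator. *)
move=> u; have [|n0 n0w] := w0 (theta / (l1_norm u + 1)).
  by rewrite divr_gt0 // ltr_wpDl // l1_norm_ge0.
pose F n := [set c *: d | c in [set c : R | `|c| <= 1] & d in
   [set \sum_(a <- s) a | s in
    [set s | [/\ size s = n, sorted (@c00_lt R) s & forall a, a \in s -> D a]]]].
have sF n : small theta (F n) by apply/small_shrink/small_sums => //; exact: ltW.
apply: small_sub (small_bigU n0 sF) => c [/TD[s [ss sDs ->]] cu].
have /andP[ws0 ws1] := w01 (size s).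
exists (size s); last first.
  by exists (w (size s)); [rewrite /= ger0_norm | exists (\sum_(a <- s) a) => //; exists s].
rewrite ltnNge; apply/negP => /n0w ws.
move: cu; rewrite pairingC pairingZr normrM ger0_norm // pairingC ltNge => /negP; apply.
have su : `|pairing (\sum_(a <- s) a) u| <= 1 * l1_norm u.
  apply: pairing_le_l1; apply: sorted_coord_le => // a /sDs; exact: D1.
have u0 := l1_norm_ge0 u.
rewrite mul1r in su; rewrite ltr_pdivlMr ?ltr_wpDl // in ws.
have := ler_wpM2l ws0 su; lra.
Qed.

End Shrinking.

(** * Block sequences in which each term is constrained by the preceding ones *)

Section Chains.
Variable R : realType.
Implicit Types (a b c d x : c00 R) (s t : seq (c00 R)).

(** Common form of the sequences from which A, B and C are built: [D t] is the set of allowed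
    successors of the history [t]. *)
Definition chain (D : seq (c00 R) -> set (c00 R)) s :=
  sorted (@c00_lt R) s /\ forall i, (i < size s)%N -> D (take i s) (nth 0 s i).

(** A vector supported below [l] cannot distinguish [c'] from the truncation of [c] at [k]; from [l]
    on, [c'] is free. *)
Definition agree k l c c' :=
  forall i, (i < l)%N -> c' i = if (i < k)%N then c i else 0.

Lemma sorted_rcons s d : sorted (@c00_lt R) (rcons s d) <->
  sorted (@c00_lt R) s /\ (s <> [::] -> c00_lt (last 0 s) d).
Proof.
case: s => [|a s] /=; first by split=> // _; split.
rewrite rcons_path; split=> [/andP[-> ->]//|[-> H]]; exact: H.
Qed.

Lemma chain_rcons D s d : chain D (rcons s d) <->
  [/\ chain D s, D s d & (s <> [::] -> c00_lt (last 0 s) d)].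
Proof.
split=> [[/sorted_rcons[ss sd] sD]|[[ss sD] Dd sd]].
  split=> //; first split=> // i si.
    have := sD i; rewrite size_rcons ltnS => /(_ (ltnW si)).
    by rewrite nth_rcons si -cats1 takel_cat // ltnW.
  have := sD (size s); rewrite size_rcons => /(_ (ltnSn _)).
  by rewrite nth_rcons ltnn eqxx -cats1 take_size_cat.
split=> [|i]; first exact/sorted_rcons.
rewrite size_rcons ltnS leq_eqVlt => /predU1P[->|si].
  by rewrite nth_rcons ltnn eqxx -cats1 take_size_cat.
by rewrite nth_rcons si -cats1 takel_cat ?(ltnW si) //; exact: sD.
Qed.

Lemma last_in s : s <> [::] -> last 0 s \in s.
Proof. by case: s => // a s _; exact: (mem_last a s). Qed.

Lemma chain_mem D (A : set (c00 R)) s : (forall t d, D t d -> A d) ->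
  chain D s -> forall a, a \in s -> A a.
Proof. by move=> DA [_ sD] a /(nthP 0)[i si <-]; apply: DA (sD i si). Qed.

Section Extension.
Variables (D : seq (c00 R) -> set (c00 R)) (n : nat).
Hypothesis D_neq0 : forall t d, D t d -> d != 0.

Lemma chain_far (Q : set (c00 R)) k :
  (forall t l, chain D t -> (size t < n)%N ->
     exists d, [/\ D t d, beyond l d & Q d]) ->
  exists s, [/\ chain D s, size s = n & forall a, a \in s -> beyond k a /\ Q a].
Proof.
move=> far; have [m] := ubnP n; elim: n far m => [|n' IH] far m.
  by exists [::]; split=> //; split.
move=> _; have [|s [sc sz sQ]] := IH _ n'.+1 (ltnSn _).
  by move=> t l tc tn; apply: far => //; apply: ltnW.
have [l sl] := c00_below (last 0 s).
have [|d [Dd dl Qd]] := far s (maxn k l) sc; first by rewrite sz.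
exists (rcons s d); rewrite size_rcons sz; split=> //.
  apply/chain_rcons; split=> // s0; apply/c00_ltP; split.
  - apply: (chain_mem (A := [set a | a != 0]) D_neq0 sc).
    exact: last_in s0.
  - exact: D_neq0 Dd.
  - by exists l; split=> //; exact: beyondW (leq_maxr _ _) dl.
move=> a; rewrite mem_rcons inE => /predU1P[->|/sQ//].
by split=> //; exact: beyondW (leq_maxl _ _) dl.
Qed.

(** Terms ending before [k] are kept, and the first term reaching [k] is replaced by one that agrees
    with its truncation. This changes the history, hence the sets allowed afterwards, so the
    remaining terms are chosen afresh beyond [l]; the length is preserved. *)
Lemma chain_agree k l : (k <= l)%N ->
  (forall t d, chain D t -> (size t < n)%N -> D t d ->
     exists2 d', D t d' & agree k l d d') ->
  (forall t l, chain D t -> (size t < n)%N -> exists2 d, D t d & beyond l d) ->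
  forall s, chain D s -> size s = n -> exists s', [/\ chain D s', size s' = n &
    agree k l (\sum_(a <- s) a) (\sum_(a <- s') a)].
Proof.
move=> kl ext far s sc sz.
(* The induction has two states: nothing replaced yet, or some term has already reached [k]. *)
suff: exists s', [/\ chain D s', size s' = size s &
    s' = s /\ (forall a, a \in s -> below k a) \/
    agree k l (\sum_(a <- s) a) (\sum_(a <- s') a) /\ exists2 a, a \in s & ~ below k a].
  move=> [s' [s'c s'z s'P]]; exists s'; split; [by []| by rewrite s'z |].
  case: s'P => [[-> sk] i il|[]//]; case: ltnP => // ki.
  by rewrite (below_sum sk).
move: sc; have : (size s <= n)%N by rewrite sz.
elim/last_ind: s {sz} => [|s d IH]; first by exists [::]; split=> //; left.
rewrite size_rcons => sn /chain_rcons[sc Dd sd].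
have [s' [s'c s'z s'P]] := IH (ltnW sn) sc.
have sum_rcons t b : \sum_(a <- rcons t b) a = \sum_(a <- t) a + b.
  by rewrite -cats1 big_cat big_seq1.
case: s'P => [[s's sk]|[s'a [a as_ nak]]].
  have [dk|ndk] := pselect (below k d).
    exists (rcons s d); rewrite size_rcons; split=> //; first exact/chain_rcons.
    by left; split=> // a; rewrite mem_rcons inE => /predU1P[->|/sk].
  have [d' Dd' dd'] := ext _ _ sc sn Dd.
  exists (rcons s d'); rewrite size_rcons; split=> //.
    apply/chain_rcons; split=> // s0; have /c00_ltP[l0 _ [j [sj dj]]] := sd s0.
    apply/c00_ltP; split=> //; first exact: D_neq0 Dd'.
    have lk : below k (last 0 s).
      exact: sk (last_in s0).
    (* The last kept term ends before both bounds; below [minn j k] the replacement agrees with [d],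
       which vanishes before [j]. *)
    exists (minn j k); split=> i.
      by rewrite geq_min => /orP[/sj|/lk].
    rewrite ltn_min => /andP[ij ik].
    by rewrite dd' ?(leq_trans ik kl) // ik dj.
  right; split; last by exists d => //; rewrite mem_rcons mem_head.
  move=> i il; rewrite !sum_rcons !c00D dd' //; case: ltnP => // ki.
  by rewrite (below_sum sk) // addr0.
have s0 : s <> [::] by move=> s0; rewrite s0 in as_.
have s'0 : s' <> [::] by move=> s0'; apply: s0; apply/size0nil; rewrite -s'z s0'.
(* Some earlier term reaches [k], so [d] lies beyond [k] and adds nothing to the truncation. *)
have dk : beyond k d.
  have [s1 _] : chain D (rcons s d) by apply/chain_rcons.
  have ad : c00_lt a d.
    move: s1; rewrite (sorted_pairwise (@c00_lt_trans R)) -cats1 pairwise_cat allrel1r.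
    by move=> /andP[/allP/(_ a as_)].
  have /c00_ltP[_ _ [j [aj dj]]] := ad; apply: beyondW dj.
  by rewrite leqNgt; apply/negP => jk; apply: nak; apply: belowW aj; apply: ltnW.
have [j sj] := c00_below (last 0 s').
have [|d' Dd' d'l] := far s' (maxn l j) s'c; first by rewrite s'z.
exists (rcons s' d'); rewrite !size_rcons s'z; split=> //.
  apply/chain_rcons; split=> // _; apply/c00_ltP; split.
  - apply: (chain_mem (A := [set a | a != 0]) D_neq0 s'c).
    exact: last_in s'0.
  - exact: D_neq0 Dd'.
  - by exists j; split=> //; exact: beyondW (leq_maxr _ _) d'l.
right; split; last by exists a => //; rewrite mem_rcons inE as_ orbT.
move=> i il; rewrite !sum_rcons !c00D (beyondW (leq_maxl l j) d'l) // addr0 s'a //.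
by case: ifP => // ik; rewrite dk // addr0.
Qed.

End Extension.

Section Admissible.
Variables (M : nat -> nat) (sigma : seq (c00 R) -> nat).

(** Admissibility as a rule for successors. The length [n] is fixed in advance because [M n]
    restricts the first term. *)
Definition adm_next (A : set (c00 R)) (D : nat -> set (c00 R)) (n : nat) t : set (c00 R) :=
  [set d | A d /\
    if t is [::] then exists2 i, (M n <= i)%N & D i d else D (sigma t) d].

Lemma admissible_chain (A : set (c00 R)) D n s : (0 < n)%N ->
  [/\ size s = n, forall a, a \in s -> A a & admissible M sigma D s] <->
  size s = n /\ chain (adm_next A D n) s.
Proof.
move=> n0; split=> [[sz sA [s0 ss [i Mi Di] sD]]|[sz [ss sD]]].
  split=> //; split=> // -[|j] js; split; try exact/sA/mem_nth.
    by rewrite take0; exists i; rewrite -?sz.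
  by case: s {sz sA s0 ss Mi Di} sD js => // a s sD js; exact: sD.
have s_gt0 : (0 < size s)%N by rewrite sz.
split=> // [a /(nthP 0)[i si <-]|]; first exact: (sD i si).1.
split=> //; first by move=> s0; rewrite s0 in s_gt0.
  by have := (sD 0%N s_gt0).2; rewrite take0 sz.
move=> i si; have := (sD _ si).2.
by case: (s) s_gt0.
Qed.

End Admissible.
End Chains.

(** * The weights [1 / f(n)] *)

Section Weights.
Variable R : realType.

Lemma logf_ge1 n : (0 < n)%N -> 1 <= logf (n%:R : R).
Proof.
move=> n0; have l2 : 0 < ln 2 :> R by rewrite ln_gt0 // ltr1n.
have n1 : 0 < n%:R + 1 :> R by rewrite ltr_wpDl.
rewrite /logf ler_pdivlMr // mul1r ler_ln ?posrE //.
by rewrite -[2]/(1 + 1) lerD2r ler1n.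
Qed.

Lemma logf_inv01 n : 0 <= (logf (n%:R : R))^-1 <= 1.
Proof.
(* At [n = 0] the logarithm vanishes, and the convention [0^-1 = 0] keeps the claim true. *)
have [->|n0] := posnP n; first by rewrite /logf add0r ln1 mul0r invr0 lexx ler01.
have := @logf_ge1 n n0 => l1; have l0 : 0 < logf (n%:R : R) by apply: lt_le_trans l1.
by apply/andP; split; [rewrite invr_ge0 ltW | rewrite invf_le1].
Qed.

Lemma logf1 : logf (1 : R) = 1.
Proof. by rewrite /logf divff // gt_eqF // ln_gt0 // ltrDl. Qed.

Lemma logf_inv_small (e : R) : 0 < e ->
  exists n0, forall n, (n0 <= n)%N -> (logf (n%:R : R))^-1 < e.
Proof.
move=> e0; have l2 : 0 < ln 2 :> R by rewrite ln_gt0 // ltr1n.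
(* [expR (ln 2 / e)] is [2] to the power [1 / e]. *)
exists (Num.truncn (expR (ln 2 / e))).+1 => n n0n.
have En : expR (ln 2 / e) < n%:R + 1.
  by rewrite (lt_le_trans (truncnS_gt _)) // ler_wpDr // ler_nat.
rewrite /logf invf_div ltr_pdivrMr; last first.
  by rewrite ln_gt0 // ltrDr ltr0n (leq_trans _ n0n).
rewrite mulrC -ltr_pdivrMr // -[X in X < _]expRK ltr_ln ?posrE ?expR_gt0 //.
Qed.

(* For [n = k ^ 2 - 1], [ln (n + 1) = 2 ln k <= 2 (k - 1)]. *)
Lemma n_over_logf_unbounded (C : R) :
  exists2 n, (2 <= n)%N & C < n%:R / logf (n%:R : R).
Proof.
have l2 : 0 < ln 2 :> R by rewrite ln_gt0 // ltr1n.
pose j := (Num.truncn (2 * `|C| / ln 2)).+1.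
have Cj : `|C| < j%:R * ln 2 / 2.
  by rewrite ltr_pdivlMr // mulrC -ltr_pdivrMr // truncnS_gt.
have j0 : 0 < j%:R :> R by rewrite ltr0n.
exists (j * j.+2)%N; first by rewrite (leq_trans _ (leq_pmull _ _)).
have lnj : ln (j%:R + 1) <= j%:R :> R by rewrite addrC le_ln1Dx // (lt_trans _ j0) // ltrN10.
have E : (j * j.+2)%:R + 1 = (j%:R + 1) ^+ 2 :> R.
  by rewrite natrM -[j.+2]addn2 natrD; ring.
rewrite /logf E lnXn ?addr_gt0 // invf_div -[ln _ *+ 2]mulr_natl mulrA.
have lj : 0 < ln (j%:R + 1) :> R by rewrite ln_gt0 // ltrDr.
rewrite ltr_pdivlMr ?mulr_gt0 //.
apply: le_lt_trans (_ : `|C| * (2 * j%:R) < _).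
  rewrite (le_trans (ler_norm _)) // normrM ler_wpM2l //.
  have l0 : 0 <= 2 * ln (j%:R + 1) :> R by apply: mulr_ge0 => //; exact: ltW.
  by rewrite (ger0_norm l0) ler_wpM2l.
apply: lt_le_trans (_ : (j%:R * ln 2 / 2) * (2 * j%:R) <= _).
  by rewrite ltr_pM2r // mulr_gt0.
have -> : j%:R * ln 2 / 2 * (2 * j%:R) = j%:R * j%:R * ln 2 :> R by field.
by rewrite ler_pM2r // natrM ler_pM2l // ler_nat (ltnW (ltnW (ltnSn _))).
Qed.

End Weights.

(** * The sets A, B and C as families of chains *)

Section Families.
Variables (R : realType) (H : set (c00 R)) (M : nat -> nat) (sigma : seq (c00 R) -> nat).
Hypotheses (hH : H_conditions H) (hM : M_conditions M) (hsigma : sigma_conditions H sigma).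
Implicit Types (a b c d x : c00 R) (s t : seq (c00 R)).

Lemma H_neq0 a : H a -> a != 0.
Proof. by have [_ h _ _ _] := hH => /h[]. Qed.

Lemma H_coord a : H a -> forall i, `|a i| <= 1.
Proof. by have [_ h _ _ _] := hH => /h[]. Qed.

Lemma M_ge2 n : (0 < n)%N -> (2 <= M n)%N.
Proof.
have [M1 Mi] := hM; case: n => [//|[|n]] _; first by rewrite M1.
by rewrite -M1 ltnW // Mi.
Qed.

(** By [sigma2] the value exceeds an index in the support of the last term, and supports start at
    [1]. *)
Lemma sigma_ge2 t : t <> [::] -> sorted (@c00_lt R) t -> (forall a, a \in t -> H a) ->
  (2 <= sigma t)%N.
Proof.
have [_ _ s2 _ _] := hsigma; case/lastP: t => // t a _ ts tH.
have Ha : H a by apply: tH; rewrite mem_rcons mem_head.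
have [i ai _] := c00_last (H_neq0 Ha).
have i0 : (0 < i)%N by rewrite lt0n; apply: contraNneq ai => ->; rewrite c00_at0.
apply: leq_ltn_trans i0 (s2 t a _ i ai); split=> //.
by case: (t).
Qed.

Section FixedNorm.
Variable N : c00 R -> R.

Lemma AXm_H p : (0 < p)%N -> AXm H N p `<=` H.
Proof.
move=> p0 _ [s [sz ss sH] <-]; have [_ _ _ _ h] := hH.
have [|_ _] := h s _; last by rewrite sz.
split=> // [s0|a /sH[]//]; by rewrite -sz s0 in p0.
Qed.

Lemma AX_H : AX H N `<=` H.
Proof. by move=> a [p /= p2]; apply: AXm_H; apply: leq_trans p2. Qed.

Lemma BXm_H n : (0 < n)%N -> BXm H M sigma N n `<=` H.
Proof.
move=> n0 _ [s [sz sA [s0 ss _ _]] <-]; have [_ _ _ _ h] := hH.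
have [|_] := h s _; last by rewrite sz.
by split=> // a /sA; apply: AX_H.
Qed.

Lemma BX_H : BX H M sigma N `<=` H.
Proof. by move=> a [p /= p2]; apply: BXm_H; apply: leq_trans p2. Qed.

Lemma CX_coord c : CX H M sigma N c -> forall i, `|c i| <= 1.
Proof.
move=> [m /= m0 [s [sz sB [_ ss _ _]] <-]] i.
have /andP[w0 w1] := @logf_inv01 R m.
rewrite c00Z normrM ger0_norm // mulr_ile1 // sorted_coord_le // => a /sB/BX_H.
exact: H_coord.
Qed.

(** One-term sequences suffice: [f(1) = 1], and [M 1 = 2] lets any index at least [2] start an
    admissible sequence. *)
Lemma sub_BX_CX : BX H M sigma N `<=` CX H M sigma N.
Proof.
move=> b [n /= n2 bn]; exists 1%N => //; exists [:: b]; last first.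
  by rewrite big_seq1 logf1 invr1 scale1r.
split=> //; first by move=> a; rewrite inE => /eqP->; exists n.
by split=> //; exists n => //; rewrite /= hM.1.
Qed.

Definition nextB n := adm_next M sigma (AX H N) (tilde_A H N) n.
Definition nextC n := adm_next M sigma (BX H M sigma N) (BXm H M sigma N) n.

Lemma nextB_H n t d : nextB n t d -> H d. Proof. by move=> [/AX_H]. Qed.
Lemma nextC_H n t d : nextC n t d -> H d. Proof. by move=> [/BX_H]. Qed.

(** The threshold is [M n] for the empty history and [sigma t] otherwise; both are at least [2], so
    the new term lies in [AX] too. *)
Lemma AXm_nextB n t : (0 < n)%N -> (forall a, a \in t -> H a) ->
  sorted (@c00_lt R) t ->
  exists2 p, (2 <= p)%N & forall i d, (p <= i)%N -> AXm H N i d -> nextB n t d.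
Proof.
move=> n0 tH ts; case: t tH ts => [|a t] tH ts.
  exists (M n) => [|i d Mi di]; first exact: M_ge2.
  split; first by exists i => //=; exact: leq_trans (M_ge2 n0) Mi.
  by exists (M n) => //; exists i.
have p2 := sigma_ge2 _ ts tH; exists (sigma (a :: t)) => [|i d pi di]; first exact: p2.
by split; [exists i => //=; apply: leq_trans pi; exact: p2 | exists i].
Qed.

(** Admissibility restricts a term only through the index of its set, so the term may be exchanged
    within that set. This allows truncation inside a chain. *)
Lemma nextB_AXm n t d : (0 < n)%N -> (forall a, a \in t -> H a) ->
  sorted (@c00_lt R) t -> nextB n t d ->
  exists2 i, (2 <= i)%N & AXm H N i d /\ forall d', AXm H N i d' -> nextB n t d'.
Proof.
move=> n0 tH ts [_]; case: t tH ts => [|a t] tH ts.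
  move=> [j Mj [i /= ji di]]; have i2 := leq_trans (leq_trans (M_ge2 n0) Mj) ji.
  exists i => //; split=> // d' d'i; split; first by exists i.
  by exists j => //; exists i.
move=> [i /= pi di]; have i2 := leq_trans (sigma_ge2 (t := a :: t) _ ts tH) pi.
by exists i; [exact: i2 | split=> // d' d'i; split; exists i => //; exact: i2].
Qed.

(** In contrast with [tilde_A], a non-empty history prescribes the index exactly. *)
Lemma BXm_nextC n t : (0 < n)%N -> (forall a, a \in t -> H a) ->
  sorted (@c00_lt R) t ->
  exists2 p, (2 <= p)%N & forall d, BXm H M sigma N p d -> nextC n t d.
Proof.
move=> n0 tH ts; case: t tH ts => [|a t] tH ts.
  exists (M n) => [|d di]; first exact: M_ge2.
  by split; [exists (M n) => //=; exact: M_ge2 | exists (M n)].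
have p2 := sigma_ge2 _ ts tH; exists (sigma (a :: t)) => [|d di]; first exact: p2.
by split=> //; exists (sigma (a :: t)) => //; exact: p2.
Qed.

Lemma nextC_BXm n t d : (0 < n)%N -> (forall a, a \in t -> H a) ->
  sorted (@c00_lt R) t -> nextC n t d ->
  exists2 i, (2 <= i)%N & BXm H M sigma N i d /\ forall d', BXm H M sigma N i d' -> nextC n t d'.
Proof.
move=> n0 tH ts [_]; case: t tH ts => [|a t] tH ts.
  move=> [i Mi di]; have i2 := leq_trans (M_ge2 n0) Mi.
  exists i => //; split=> // d' d'i; split; first by exists i.
  by exists i.
move=> di; have i2 := sigma_ge2 (t := a :: t) _ ts tH.
exists (sigma (a :: t)); first exact: i2.
by split=> // d' d'i; split=> //; exists (sigma (a :: t)) => //; exact: i2.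
Qed.

Lemma BXmE n b : (0 < n)%N -> BXm H M sigma N n b <->
  exists s, [/\ size s = n, chain (nextB n) s & b = (logf n%:R)^-1 *: \sum_(a <- s) a].
Proof.
move=> n0; split=> [[s] sP <-|[s [sz sc ->]]].
  by have [sz sc] := (admissible_chain _ _ _ _ _ n0).1 sP; exists s.
by exists s => //; apply/(admissible_chain _ _ _ _ _ n0).
Qed.

Lemma CXmE n b : (0 < n)%N -> CXm H M sigma N n b <->
  exists s, [/\ size s = n, chain (nextC n) s & b = (logf n%:R)^-1 *: \sum_(a <- s) a].
Proof.
move=> n0; split=> [[s] sP <-|[s [sz sc ->]]].
  by have [sz sc] := (admissible_chain _ _ _ _ _ n0).1 sP; exists s.
by exists s => //; apply/(admissible_chain _ _ _ _ _ n0).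
Qed.

(** * Elements of A and B far out, with a lower bound on a given sequence *)

Section Far.
Variables (y : nat -> R^o) (q : R).
Hypothesis far : forall k, exists h, [/\ (H `&` dual_ball N) h, beyond k h & q <= dot h y].

Lemma dot_sum_ge s : (forall a, a \in s -> q <= dot a y) ->
  (size s)%:R * q <= dot (\sum_(a <- s) a) y.
Proof.
elim: s => [|a s IH] sq; first by rewrite big_nil dot0l mul0r.
rewrite big_cons dotDl [size _]/= -natr1 mulrDl mul1r addrC lerD //.
  by apply: sq; rewrite mem_head.
by apply: IH => b bs; apply: sq; rewrite inE bs orbT.
Qed.

Lemma beyondZ k (e : R) a : beyond k a -> beyond k (e *: a).
Proof. by move=> ak i ik; rewrite c00Z ak // mulr0. Qed.

Lemma AXm_far p k : (0 < p)%N -> exists a, [/\ AXm H N p a, beyond k a & q <= dot a y].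
Proof.
move=> p0.
have [||s [[ss sD] sz sQ]] := @chain_far R (fun=> H `&` dual_ball N) p _ [set a | q <= dot a y] k.
- by move=> _ d [/H_neq0].
- by move=> t l _ _; have [h [? ? ?]] := far l; exists h.
exists (p%:R^-1 *: \sum_(a <- s) a); split.
- exists s => //; split=> // a /(nthP 0)[i si <-]; exact: sD si.
- by apply/beyondZ/beyond_sum => a /sQ[].
- rewrite dotZl ler_pdivlMl ?ltr0n // -sz.
  by apply: dot_sum_ge => a /sQ[].
Qed.

(** Each of the [n] averages contributes at least [q]. With [y = 0] and [q = 0] this only supplies
    elements far out; with [q > 0] the values are unbounded in [n]. *)
Lemma BXm_far n k : (0 < n)%N ->
  exists b, [/\ BXm H M sigma N n b, beyond k b & n%:R / logf n%:R * q <= dot b y].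
Proof.
move=> n0.
have [||s [sc sz sQ]] := @chain_far R (nextB n) n _ [set a | q <= dot a y] k.
- by move=> t d /nextB_H/H_neq0.
- move=> t l tc _; have tH := chain_mem (@nextB_H n) tc.
  have [p p2 pP] := AXm_nextB n0 tH tc.1.
  have [a [ap al aq]] := @AXm_far p l (ltnW p2).
  by exists a; split=> //; apply: pP ap.
exists ((logf n%:R)^-1 *: \sum_(a <- s) a); split.
- by apply/BXmE => //; exists s.
- by apply/beyondZ/beyond_sum => a /sQ[].
- rewrite dotZl mulrAC mulrC ler_wpM2l //; first by have /andP[] := @logf_inv01 R n.
  by rewrite -sz; apply: dot_sum_ge => a /sQ[].
Qed.

End Far.

End FixedNorm.
End Families.

(** * Completing truncations of elements of A, B and C *)

Section Truncation.
Variables (R : realType) (H : set (c00 R)) (M : nat -> nat) (sigma : seq (c00 R) -> nat).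
Hypotheses (hH : H_conditions H) (hM : M_conditions M) (hsigma : sigma_conditions H sigma).
Implicit Types (a b c d x : c00 R) (s t : seq (c00 R)).
Variable W : normset R.
Hypothesis nrm_trunc : forall k x, nrm W (trunc k x) <= nrm W x.
Let N x := nrm W x.
Let HB := H `&` dual_ball N.

(** The restriction is a unit functional times a scalar of modulus at most [1]. *)
Lemma H_restr_dual_ball a i : H a -> a i.+1 != 0 -> HB (restr [set i.+1] a).
Proof.
move=> Ha ai; have aE : restr [set i.+1] a = a i.+1 *: unitv R i.
  apply: c00E => j; rewrite c00Z /=; case: (eqVneq j i.+1) => [->|ji].
    by rewrite mulr1 ifT // inE.
  by rewrite mulr0 ifF //; apply/negbTE/negP; rewrite inE /= => /eqP; apply/negP.
split.
  have [_ _ _ h _] := hH; apply: h => //; first by move=> k j l -> -> /anti_leq.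
  rewrite aE; apply: contraNneq ai => /(congr1 (fun z : c00 R => z i.+1)).
  by rewrite c00Z /= eqxx mulr1 => ->.
apply/dual_ballP => x; rewrite aE pairingC pairingZr normrM pairingC.
rewrite -[leRHS]mul1r ler_pM //; first exact: H_coord hH a Ha i.+1.
exact/pairing_le_nrm/ns_unitv.
Qed.

(** An element of [H] at [l1] distance less than [1] from [unitv R k] cannot vanish at [k.+1], and
    only that coordinate is kept. The last clause has the form required for [far]. *)
Lemma HB_far k : exists h, [/\ HB h, beyond k h & 0 <= dot h 0].
Proof.
have [_ _ dens _ _] := hH.
have [|a Ha ak] := dens (unitv R k) _ 1 ltr01.
  by move=> i /=; case: (i == _); rewrite ?normr1 ?normr0.
exists (restr [set k.+1] a); split; last by rewrite dot0r.
- apply: H_restr_dual_ball => //; apply: contraTneq ak => a0.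
  rewrite -leNgt (le_trans _ (coord_le_l1 _ k.+1)) //.
  by rewrite c00D c00N a0 subr0 /= eqxx normr1.
- move=> i ik /=; rewrite ifF //; apply/negbTE/negP; rewrite inE /= => ik1.
  by move: ik; rewrite ik1 ltnNge leqnSn.
Qed.

(** Truncation stays in [H] by the interval property and in the dual ball by monotonicity. As [0] is
    not in [H], a zero truncation is replaced by an element beyond [l]. *)
Lemma HB_agree k l d : (k <= l)%N -> HB d -> exists2 d', HB d' & agree k l d d'.
Proof.
move=> kl [Hd Bd]; have [tk0|tk0] := eqVneq (trunc k d) 0.
  have [h [hB hl _]] := HB_far l; exists h => // i il; rewrite hl //.
  by case: ifP => // ik; rewrite -(c00_0 R i) -tk0 trunc_seqE ik.
exists (trunc k d); last by move=> i il; rewrite trunc_seqE.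
split.
  rewrite trunc_restr; have [_ _ _ h _] := hH; apply: h; rewrite -?trunc_restr //.
  by move=> u v w /= uk wk /andP[_ vw]; apply: leq_ltn_trans vw wk.
apply/dual_ballP => x; rewrite pairing_dot dot_trunc.
by apply: le_trans (nrm_trunc k x); apply: (dual_ballP W d).1.
Qed.

Lemma agreeZ k l (e : R) c c' : agree k l c c' -> agree k l (e *: c) (e *: c').
Proof. by move=> cc i il; rewrite !c00Z cc //; case: ifP => // _; rewrite mulr0. Qed.

(** First of three applications of [chain_agree], for A, B and C in turn: the level below truncates
    the critical term and supplies the far ones. *)
Lemma AXm_agree p k l d : (0 < p)%N -> (k <= l)%N -> AXm H N p d ->
  exists2 d', AXm H N p d' & agree k l d d'.
Proof.
move=> p0 kl [s [sz ss sH] <-].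
have [||||s' [[s's s'D] s'z s's'']] :=
    @chain_agree R (fun=> HB) p _ k l kl _ _ s _ sz.
- by move=> _ d' [/(H_neq0 hH)].
- by move=> t d' _ _; apply: HB_agree.
- by move=> t j _ _; have [h [? ? _]] := HB_far j; exists h.
- by split=> // i si; apply/sH/mem_nth.
exists (p%:R^-1 *: \sum_(a <- s') a); last exact: agreeZ.
by exists s' => //; split=> // a /(nthP 0)[i si <-]; exact: s'D si.
Qed.

Lemma BXm_agree n k l d : (0 < n)%N -> (k <= l)%N -> BXm H M sigma N n d ->
  exists2 d', BXm H M sigma N n d' & agree k l d d'.
Proof.
move=> n0 kl /BXmE -/(_ n0) [s [sz sc ->]].
have [|||s' [s'c s'z s's'']] :=
    @chain_agree R (nextB H M sigma N n) n _ k l kl _ _ s sc sz.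
- by move=> t d' /nextB_H/(H_neq0 hH); apply.
- move=> t d' tc _ Dd'; have tH := chain_mem (@nextB_H _ _ M sigma hH N n) tc.
  have [i i2 [di iP]] := nextB_AXm hH hM hsigma n0 tH tc.1 Dd'.
  by have [d'' /iP ? ?] := AXm_agree (ltnW i2) kl di; exists d''.
- move=> t j tc _; have tH := chain_mem (@nextB_H _ _ M sigma hH N n) tc.
  have [p p2 pP] := AXm_nextB hH hM hsigma N n0 tH tc.1.
  by have [a [/pP ? ? _]] := AXm_far hH HB_far j (ltnW p2); exists a => //; auto.
exists ((logf n%:R)^-1 *: \sum_(a <- s') a); last exact: agreeZ.
by apply/BXmE => //; exists s'.
Qed.

Lemma CXm_agree n k l d : (0 < n)%N -> (k <= l)%N -> CXm H M sigma N n d ->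
  exists2 d', CXm H M sigma N n d' & agree k l d d'.
Proof.
move=> n0 kl /CXmE -/(_ n0) [s [sz sc ->]].
have [|||s' [s'c s'z s's'']] :=
    @chain_agree R (nextC H M sigma N n) n _ k l kl _ _ s sc sz.
- by move=> t d' /nextC_H/(H_neq0 hH); apply.
- move=> t d' tc _ Dd'; have tH := chain_mem (@nextC_H _ _ M sigma hH N n) tc.
  have [i i2 [di iP]] := nextC_BXm hH hM hsigma n0 tH tc.1 Dd'.
  by have [d'' /iP ? ?] := BXm_agree (ltnW i2) kl di; exists d''.
- move=> t j tc _; have tH := chain_mem (@nextC_H _ _ M sigma hH N n) tc.
  have [p p2 pP] := BXm_nextC hH hM hsigma N n0 tH tc.1.
  by have [a [/pP ? ? _]] := BXm_far hH hM hsigma HB_far j (ltnW p2); exists a.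
exists ((logf n%:R)^-1 *: \sum_(a <- s') a); last exact: agreeZ.
by apply/CXmE => //; exists s'.
Qed.

(** With [l] beyond both [k] and the support of [x], the free part of [c'] is invisible to [x]. *)
Lemma CX_trunc k x c : CX H M sigma N c ->
  exists2 c', CX H M sigma N c' & pairing c' x = pairing c (trunc k x).
Proof.
move=> [m /= m0 cm]; have [j xj] := c00_below x.
have [c' c'm cc'] := CXm_agree m0 (leq_maxl k j) cm.
exists c'; first by exists m.
have xl := belowW (leq_maxr k j) xj.
have txl := belowW (leq_maxl k j) (@below_trunc _ k x).
rewrite !pairing_dot (dotEr _ xl) (dotEr _ txl); apply: eq_bigr => i _.
by rewrite trunc_seqE cc' //; case: ifP => // _; rewrite mulr0 mul0r.
Qed.

End Truncation.

(** * A norming set that reproduces itself *)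

Section FixedPoint.
Variables (R : realType) (H : set (c00 R)) (M : nat -> nat) (sigma : seq (c00 R) -> nat).
Hypotheses (hH : H_conditions H) (hM : M_conditions M) (hsigma : sigma_conditions H sigma).
Implicit Types (W : set (c00 R)).

(** The witness may depend on [x], since its tail has to be moved away from the support of [x]; this
    still makes the norm monotone. *)
Definition trunc_closed W := forall k x w, W w ->
  exists2 w', W w' & pairing w' x = pairing w (trunc k x).

Definition good W := [/\ forall i, W (unitv R i),
  forall w, W w -> forall i, `|w i| <= 1 & trunc_closed W].

Definition good_normset W (gW : good W) : normset R :=
  let: And3 Wu Wc _ := gW in NormSet Wu Wc.

Lemma good_normsetE W (gW : good W) : good_normset gW = W :> set (c00 R).
Proof. by case: gW. Qed.

Lemma nrm_trunc_closed (W : normset R) : trunc_closed W ->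
  forall k (x : c00 R), nrm W (trunc k x) <= nrm W x.
Proof.
move=> Wt k x; apply: nrm_le => w Ww; have [w' W'w' E] := Wt k x w Ww.
rewrite -pairing_dot -E; exact: pairing_le_nrm.
Qed.

Definition next_set W : set (c00 R) :=
  range (unitv R) `|` CX H M sigma (fun x => nrm W x).

Lemma good_next_set W : good W -> good (next_set W).
Proof.
move=> gW; have [Wu Wc Wt] := gW; split.
- by move=> i; left; exists i.
- move=> w [[j _ <-]|/(CX_coord hH)] i //=.
  by case: (i == _); rewrite ?normr1 ?normr0.
- move=> k x w [[j _ <-]|Cw].
    have [jk|kj] := ltnP j.+1 k.
      exists (unitv R j); first by left; exists j.
      by rewrite !pairing_dot !dot_unitv trunc_seqE jk.
    (* The truncation kills the coordinate; a unit functional beyond the support of [x] also gives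
       [0]. *)
    have [l xl] := c00_below x.
    exists (unitv R l); first by left; exists l.
    by rewrite !pairing_dot !dot_unitv trunc_seqE ltnNge kj /= xl // ltnW.
  have nt : forall k (x : c00 R), nrm (good_normset gW) (trunc k x) <= nrm (good_normset gW) x.
    by apply: nrm_trunc_closed; rewrite good_normsetE.
  rewrite -(good_normsetE gW) in Cw.
  have [c' C'c' c'x] := CX_trunc hH hM hsigma nt k x Cw.
  by exists c' => //; right; rewrite good_normsetE in C'c'.
Qed.

Lemma dual_ballS (N N' : c00 R -> R) : (forall x, N x <= N' x) ->
  dual_ball N `<=` dual_ball N'.
Proof.
move=> NN a; apply: le_trans; apply: le_ereal_sup => _ [x x1 <-].
by exists x => //=; apply: le_trans x1.
Qed.

Lemma CXS (N N' : c00 R -> R) : (forall x, N x <= N' x) ->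
  CX H M sigma N `<=` CX H M sigma N'.
Proof.
move=> NN; have Am p : AXm H N p `<=` AXm H N' p.
  move=> _ [s [sz ss sH] <-]; exists s => //; split=> // a /sH[Ha Ba].
  by split=> //; apply: dual_ballS Ba.
have A : AX H N `<=` AX H N' by move=> a [p p2 /Am ap]; exists p.
have tA p : tilde_A H N p `<=` tilde_A H N' p by move=> a [i ip /Am ap]; exists i.
have adm D D' s : (forall i, D i `<=` D' i) -> admissible M sigma D s ->
    admissible M sigma D' s.
  move=> DD [s0 ss [i Mi Di] sD]; split=> //; first by exists i => //; exact: DD.
  by move=> j js; apply: DD; exact: sD.
have Bm n : BXm H M sigma N n `<=` BXm H M sigma N' n.
  move=> _ [s [sz sA sadm] <-]; exists s => //; split=> // [a /sA/A//|].
  exact: adm tA sadm.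
have B : BX H M sigma N `<=` BX H M sigma N' by move=> a [p p2 /Bm ap]; exists p.
move=> _ [m m0 [s [sz sB sadm] <-]]; exists m => //; exists s => //; split=> //.
  by move=> a /sB/B.
exact: adm Bm sadm.
Qed.

(* Knaster-Tarski on norming sets: the union of all good sets contained in
   their image is a fixed point. *)
Lemma fixed_point : exists2 W : normset R, trunc_closed W &
  forall w, ns_set W w <-> next_set W w.
Proof.
have mono W W' : good W -> good W' -> W `<=` W' -> next_set W `<=` next_set W'.
  move=> gW gW' WW w [Uw|Cw]; [by left | right]; apply: CXS Cw => x.
  rewrite -{1}(good_normsetE gW) -(good_normsetE gW'); apply: subset_nrm.
    exact: nrm_bounded_c00.
  by rewrite !good_normsetE.
pose F : set (c00 R) := [set w | exists W, [/\ good W, W `<=` next_set W & W w]].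
have gU : good (range (unitv R)).
  split; first by move=> i; exists i.
    by move=> _ [j _ <-] i /=; case: (i == _); rewrite ?normr1 ?normr0.
  move=> k x _ [j _ <-]; have [jk|kj] := ltnP j.+1 k.
    by exists (unitv R j); [exists j | rewrite !pairing_dot !dot_unitv trunc_seqE jk].
  have [l xl] := c00_below x; exists (unitv R l); first by exists l.
  by rewrite !pairing_dot !dot_unitv trunc_seqE ltnNge kj /= xl // ltnW.
have gF : good F.
  split.
  - move=> i; exists (range (unitv R)); split; [exact: gU | by move=> w; left |].
    by exists i.
  - by move=> w [W [[_ Wc _] _ /Wc]].
  - move=> k x w [W [gW WW Ww]]; have [_ _ Wt] := gW.
    by have [w' W'w' ?] := Wt k x w Ww; exists w' => //; exists W.
have FN : F `<=` next_set F.
  move=> w [W [gW WW Ww]]; apply: (mono W) => //; last exact: WW.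
  by move=> v Wv; exists W.
have NF : next_set F `<=` F.
  (* By monotonicity [next_set F] is itself a good set contained in its image, hence a member of the
     union. *)
  move=> w Nw; exists (next_set F); split=> //; first exact: good_next_set.
  by apply: mono => //; exact: good_next_set.
exists (good_normset gF) => [|w]; rewrite good_normsetE; first by case: gF.
by split; [exact: FN | exact: NF].
Qed.

End FixedPoint.

(** * The Banach space of all sequences of finite norm *)

Section SequenceSpace.
Variables (R : realType) (W : normset R).

(** This space is complete for every [W]; it is a completion of [c00] as soon as truncations
    converge in norm. *)
Definition seqspace_pred : {pred (nat -> R^o)} :=
  mem [set y : nat -> R^o | y 0%N = 0 /\ nrm_bounded W y].

Lemma seqspace_predP (y : nat -> R^o) :
  reflect (y 0%N = 0 /\ nrm_bounded W y) (y \in seqspace_pred).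
Proof. by apply: (iffP idP) => [/set_mem|/mem_set]. Qed.

Fact seqspace_submod_closed : submod_closed seqspace_pred.
Proof.
split; first by apply/seqspace_predP; split=> //; exact: (nrm_bounded_c00 W 0).
move=> c x y /seqspace_predP[x0 xf] /seqspace_predP[y0 yf].
apply/seqspace_predP; split; last exact/nrm_boundedD/yf/nrm_boundedZ.
by rewrite [LHS](_ : _ = c * x 0%N + y 0%N) // x0 y0 mulr0 addr0.
Qed.

HB.instance Definition _ :=
  GRing.isSubmodClosed.Build R (nat -> R^o) seqspace_pred seqspace_submod_closed.

Record seqspace :=
  SeqSpace { seq_val :> nat -> R^o; seq_valP : seq_val \in seqspace_pred }.

HB.instance Definition _ := [isSub for seq_val].
HB.instance Definition _ := [Choice of seqspace by <:].
HB.instance Definition _ := [SubChoice_isSubLmodule of seqspace by <:].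

Lemma seqspaceE (x y : seqspace) : x =1 y -> x = y.
Proof. by move=> xy; apply/val_inj/funext. Qed.

Lemma seqspace_bounded (y : seqspace) : nrm_bounded W y.
Proof. by have /seqspace_predP[] := seq_valP y. Qed.

Lemma seqspace_at0 (y : seqspace) : y 0%N = 0.
Proof. by have /seqspace_predP[] := seq_valP y. Qed.

Fact seqspace_normD (x y : seqspace) : nrm W (x + y) <= nrm W x + nrm W y.
Proof. exact: nrmD (seqspace_bounded x) (seqspace_bounded y). Qed.

Fact seqspace_normZ (c : R) (x : seqspace) : nrm W (c *: x) = `|c| * nrm W x.
Proof. exact: nrmZ (seqspace_bounded x). Qed.

Fact seqspace_norm_eq0 (x : seqspace) : nrm W x = 0 -> x = 0.
Proof.
move=> x0; apply: seqspaceE => -[|i]; first exact: seqspace_at0.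
apply/normr0_eq0/le_anti; rewrite normr_ge0 andbT -[leRHS]x0.
exact/coord_le_nrm/seqspace_bounded.
Qed.

HB.instance Definition _ := Lmodule_isNormed.Build R seqspace
  seqspace_normD seqspace_normZ seqspace_norm_eq0.

Lemma seqspace_normE (x : seqspace) : `|x| = nrm W x.
Proof. by []. Qed.

Lemma dot_le_norm w (x : seqspace) : ns_set W w -> `|dot w x| <= `|x|.
Proof. exact: dot_le_nrm (seqspace_bounded x). Qed.

(** Coordinates are dominated by the norm, so coordinatewise limits exist. Each [w] sees finitely
    many coordinates, so estimates uniform in [w] pass to the limit. *)
Lemma seqspace_complete (F : set_system seqspace) :
  ProperFilter F -> cauchy F -> cvg F.
Proof.
move=> FF /cauchyP Fc.
have Fc' (e : R) : 0 < e -> exists u, \forall v \near F, `|u - v| < e.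
  by move=> e0; have [u Fu] := Fc e e0; exists u; move: Fu; rewrite -ball_normE.
pose coord i (y : seqspace) : R := y i.
have cc i : cvg (coord i @ F).
  apply: R_complete; apply/cauchyP => e e0.
  have [u Fu] := Fc' e e0; exists (u i); rewrite -ball_normE.
  change (\forall v \near F, `|u i - coord i v| < e); near=> v.
  have uv : `|u - v| < e by near: v.
  apply: le_lt_trans uv; rewrite /coord; case: i => [|i].
    by rewrite !seqspace_at0 subrr normr0.
  exact: (coord_le_nrm i (seqspace_bounded (u - v))).
pose y : nat -> R^o := fun i => lim (coord i @ F).
have dotF w : (fun v : seqspace => dot w v) @ F --> dot w y.
  have [k wk] := c00_below w; rewrite (dotE _ wk).
  rewrite (_ : (fun v : seqspace => dot w v) = fun v => \sum_(i < k) w i * coord i v).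
    elim: k {wk} => [|k IH].
      rewrite big_ord0 (_ : (fun v => _) = fun=> 0); first exact: cvg_cst.
      by apply/funext => v; rewrite big_ord0.
    rewrite big_ord_recr /= (_ : (fun v => _) =
      (fun v => \sum_(i < k) w i * coord i v) + fun v => w k * coord k v).
      by apply: cvgD => //; apply: cvgMl_tmp; exact: cc.
    by apply/funext => v; rewrite big_ord_recr.
  by apply/funext => v; rewrite (dotE _ wk).
have close (e : R) : 0 < e ->
    \forall u \near F, forall w : c00 R, ns_set W w -> `|dot w (seq_val u) - dot w y| <= e.
  move=> e0; have e20 : 0 < e / 2 by rewrite divr_gt0.
  have [u Fu] := Fc' _ e20; near=> u' => w Ww.
  have uu' : `|u - u'| < e / 2 by near: u'.
  have : (fun v : seqspace => `|dot w u' - dot w v|) @ F --> `|dot w u' - dot w y|.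
    by apply: cvg_norm; apply: cvgB; [exact: cvg_cst | exact: dotF].
  move=> /cvgr_to_le; apply; near=> v.
  have uv : `|u - v| < e / 2 by near: v.
  rewrite -dotBr; apply: le_trans (dot_le_norm (u' - v) Ww) _.
  rewrite (le_trans (ler_distD u _ _)) // (splitr e) distrC.
  by rewrite lerD // ltW.
have yP : y \in seqspace_pred.
  apply/seqspace_predP; split.
    rewrite /y (_ : coord 0%N = fun=> 0); first exact: lim_cst.
    by apply/funext => v; exact: seqspace_at0.
  have [u uy] := filter_ex (close 1 ltr01).
  exists (`|u| + 1) => w Ww; have := uy w Ww; have := dot_le_norm u Ww.
  have := lerB_dist (dot w y) (dot w u); rewrite distrC; lra.
apply/cvg_ex; exists (SeqSpace yP); apply/cvgrPdist_le => e e0; near=> u.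
rewrite distrC; apply: nrm_le => w Ww; rewrite dotBr; move: w Ww; near: u; exact: close.
Unshelve. all: by end_near. Qed.

HB.instance Definition _ := Uniform_isComplete.Build seqspace seqspace_complete.

End SequenceSpace.

(** * The embedding of [c00] in the sequence space *)

Section Embedding.
Variables (R : realType) (W : normset R).

Fact embed_subproof (x : c00 R) : (x : nat -> R^o) \in seqspace_pred W.
Proof. by apply/seqspace_predP; split; [exact: c00_at0 | exact: nrm_bounded_c00]. Qed.

Definition embed (x : c00 R) : seqspace W := SeqSpace (embed_subproof x).

Fact embed_linear : linear embed.
Proof. by move=> c x y; apply: seqspaceE. Qed.

HB.instance Definition _ :=
  GRing.isLinear.Build R (c00 R) (seqspace W) _ embed embed_linear.

End Embedding.

(** * The norm formula and bounded completeness of the basis *)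

Section FixedPointNorm.
Variables (R : realType) (H : set (c00 R)) (M : nat -> nat) (sigma : seq (c00 R) -> nat).
Hypotheses (hH : H_conditions H) (hM : M_conditions M) (hsigma : sigma_conditions H sigma).
Implicit Types (a b c d x : c00 R) (s t : seq (c00 R)) (y : nat -> R^o).
Variable W : normset R.
Hypothesis W_trunc : trunc_closed W.
Hypothesis W_fix : forall w, ns_set W w <-> next_set H M sigma W w.
Let N x := nrm W x.
Let HB := H `&` dual_ball N.

Lemma nrm_unitv i : nrm W (unitv R i) = 1.
Proof.
apply/le_anti/andP; split.
  apply: nrm_le => w Ww; rewrite -pairing_dot pairingC pairing_dot dot_unitv.
  exact: ns_coord Ww _.
have := coord_le_nrm i (nrm_bounded_c00 W (unitv R i)).
by rewrite /= eqxx normr1.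
Qed.

Lemma dual_norm_unitv i : dual_norm N (unitv R i) = 1%E.
Proof.
apply/le_anti/andP; split; first exact: unitv_in_dual_ball.
apply: ereal_sup_ubound; exists (unitv R i); first by rewrite /= /N nrm_unitv.
by rewrite pairing_dot dot_unitv /= eqxx normr1.
Qed.

Lemma W_CX : CX H M sigma N `<=` ns_set W.
Proof. by move=> c Cc; apply/W_fix; right. Qed.

Lemma nrm_eq x : (nrm W x)%:E = maxe (sup_norm x) (set_norm (CX H M sigma N) x).
Proof.
set m := maxe _ _.
have m_le : (m <= (nrm W x)%:E)%E.
  rewrite ge_max; apply/andP; split.
    apply: ub_ereal_sup => _ [[|i] _ <-]; rewrite lee_fin.
      by rewrite c00_at0 normr0 nrm_ge0 //; exact: nrm_bounded_c00.
    exact/coord_le_nrm/nrm_bounded_c00.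
  apply: ub_ereal_sup => _ [c /W_CX Wc <-]; rewrite lee_fin.
  exact: pairing_le_nrm.
have m_ge w : ns_set W w -> (`|dot w x|%:E <= m)%E.
  move=> /W_fix[[i _ <-]|Cw]; rewrite le_max; apply/orP; [left|right].
    by apply: ereal_sup_ubound; exists i.+1 => //; rewrite dot_unitv.
  by apply: ereal_sup_ubound; exists w.
(* [m] lies between two real numbers, so the comparison can be made in [R]. *)
have m0 := m_ge _ (ns_unitv W 0).
have mfin : m \is a fin_num.
  by rewrite fin_numElt (lt_le_trans (ltNyr _) m0) (le_lt_trans m_le) ?ltry.
apply/le_anti; rewrite m_le andbT -(fineK mfin) lee_fin.
by apply: nrm_le => w /m_ge; rewrite -{1}(fineK mfin) lee_fin.
Qed.

Lemma l1_norm_le a b : (forall i, `|a i| <= `|b i|) -> l1_norm a <= l1_norm b.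
Proof.
move=> ab; have [k bk] := c00_below b.
have ak : below k a.
  move=> i ki; apply/eqP; rewrite -normr_le0.
  by rewrite (le_trans (ab i)) // bk // normr0.
by rewrite (l1_normE ak) (l1_normE bk) ler_sum.
Qed.

(** A truncated element of [W] may leave [W], but monotonicity of the norm keeps it in the dual
    ball. *)
Lemma pairing_trunc_le w k x : ns_set W w -> `|pairing (trunc k w) x| <= nrm W x.
Proof.
move=> Ww; rewrite pairing_dot dot_trunc.
exact: le_trans (pairing_le_nrm _ Ww) (nrm_trunc_closed W_trunc k x).
Qed.

(* A functional norming a block of [y], cut to that block and approximated
   within [H]. *)
Lemma HB_far_block y (e : R) k l : nrm_bounded W y -> 0 < e -> (k <= l)%N ->
  e < nrm W (trunc l y - trunc k y) ->
  exists h, [/\ HB h, beyond k h & e / 8 <= dot h y].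
Proof.
move=> yW e0 kl /nrm_gt[w0 Ww0 ew0].
(* [W] is not assumed symmetric, so a sign is adjusted to make the value positive. *)
have [w [Ww ew]] : exists w, (ns_set W w \/ ns_set W (- w)) /\ e < dot w (trunc l y - trunc k y).
  have [p|n] := lerP 0 (dot w0 (trunc l y - trunc k y)).
    by exists w0; split; [left | rewrite ger0_norm in ew0].
  exists (- w0); split; first by right; rewrite opprK.
  by rewrite dotNl; rewrite ltr0_norm in ew0.
have wx j x : `|pairing (trunc j w) x| <= nrm W x.
  case: Ww => Ww; first exact: pairing_trunc_le.
  rewrite -(opprK w) trunc_seqN pairingC -scaleN1r pairingZr mulN1r normrN pairingC.
  exact: pairing_trunc_le.
have w1 i : `|w i| <= 1.
  by case: Ww => /(ns_coord)/(_ i) //; rewrite c00N normrN.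
have S0 := nrm_ge0 yW; set S := nrm W y in S0.
(* The difference of two truncations has dual norm at most [2], so [g] has dual norm at most [1/2],
   which leaves [1/2] for the approximation error. *)
pose g : c00 R := 4^-1 *: (trunc l w - trunc k w).
have gE i : g i = if (k <= i < l)%N then 4^-1 * w i else 0.
  rewrite c00Z c00D c00N !trunc_seqE; case: (ltnP i k) => [ik|ki] /=.
    by rewrite (leq_trans ik kl) subrr mulr0.
  by rewrite subr0; case: ifP => // _; rewrite mulr0.
have gy : e / 4 < dot g y.
  rewrite dotZl dotBl !dot_trunc -dotBr mulrC ltr_pM2l ?invr_gt0 //.
have gx x : `|pairing g x| <= 2^-1 * nrm W x.
  have -> : pairing g x = 4^-1 * (pairing (trunc l w) x - pairing (trunc k w) x).
    by rewrite !pairing_dot dotZl dotBl.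
  rewrite normrM ger0_norm // (le_trans (ler_wpM2l _ (ler_normB _ _))) //.
  have := wx l x; have := wx k x; lra.
(* The first bound keeps [h] in the dual ball; the second lets the value on [y] drop from [e / 4] by
   at most [e / 8]. *)
pose eta := Num.min 2^-1 (e / 8 / (S + 1)).
have S1 : 0 < S + 1 by rewrite ltr_wpDl.
have eta0 : 0 < eta by rewrite lt_min invr_gt0 ltr0n /= !divr_gt0.
have [_ _ dens Hrestr _] := hH.
have [|a Ha ga] := dens g _ eta eta0.
  move=> i; rewrite gE; case: ifP => _; last by rewrite normr0.
  by rewrite normrM ger0_norm // mulr_ile1 // invf_le1 ?ler1n.
pose I := [set i | (k <= i < l)%N].
(* Restriction puts the approximant beyond [k] and does not increase its distance to [g], which
   vanishes off [I]. *)
pose h := restr I a.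
have hE i : h i = if (k <= i < l)%N then a i else 0.
  by rewrite /h /=; have -> : (i \in I) = (k <= i < l)%N by apply/idP/idP; rewrite inE.
have hg : l1_norm (h - g) < eta.
  apply: le_lt_trans ga; apply: l1_norm_le => i.
  rewrite !c00D !c00N hE gE; case: ifP => _; first by rewrite distrC.
  by rewrite subrr normr0.
have hy : e / 8 <= dot h y.
  have -> : dot h y = dot g y + dot (h - g) y by rewrite dotBl addrCA subrr addr0.
  have : `|dot (h - g) y| <= S * l1_norm (h - g).
    have [j hgj] := c00_below (h - g).
    (* The norm does not control [y 0], but functionals in [c00] do not see it. *)
    rewrite (@eq_dot _ j _ y (fun i => if i is 0 then 0 else y i)) //; last by case.
    by apply: dot_le_l1 => -[|i]; [rewrite normr0 | exact: coord_le_nrm].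
  have : S * l1_norm (h - g) <= e / 8.
    apply: (@le_trans _ _ ((S + 1) * eta)).
      by rewrite ler_pM ?l1_norm_ge0 ?lerDl // ltW.
    rewrite mulrC -ler_pdivlMr // /eta ge_min lexx orbT //.
  have /ler_normlP[] := lexx `|dot (h - g) y|; lra.
have h0 : h != 0.
  by apply: contraTneq hy => ->; rewrite dot0l -ltNge divr_gt0.
exists h; split=> //; last by move=> i ik; rewrite hE leqNgt ik.
split.
  apply: Hrestr => // u v z /andP[ku _] /andP[_ zl] /andP[uv vz].
  by apply/andP; split; [exact: leq_trans uv | exact: leq_ltn_trans zl].
apply/dual_ballP => x.
have -> : pairing h x = pairing g x + pairing (h - g) x.
  by rewrite !pairing_dot dotBl addrCA subrr addr0.
have : `|pairing (h - g) x| <= nrm W x * l1_norm (h - g).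
  apply: dot_le_l1 => -[|i]; last exact/coord_le_nrm/nrm_bounded_c00.
  by rewrite c00_at0 normr0 nrm_ge0 //; exact: nrm_bounded_c00.
have : nrm W x * l1_norm (h - g) <= nrm W x * 2^-1.
  rewrite ler_wpM2l ?nrm_ge0 //; first exact: nrm_bounded_c00.
  by rewrite (le_trans (ltW hg)) // ge_min lexx.
have := gx x; have := ler_normD (pairing g x) (pairing (h - g) x); lra.
Qed.

Lemma trunc_cauchy y (e : R) : nrm_bounded W y -> 0 < e ->
  exists k0, forall k l, (k0 <= k)%N -> (k <= l)%N ->
    nrm W (trunc l y - trunc k y) <= e.
Proof.
move=> yW e0; apply: contrapT => nk0.
have far k0 : exists h, [/\ HB h, beyond k0 h & e / 8 <= dot h y].
  apply: contrapT => nh; apply: nk0; exists k0 => k l k0k kl.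
  rewrite leNgt; apply/negP => /(HB_far_block yW e0 kl)[h [hB hk hy]].
  by apply: nh; exists h; split=> //; exact: beyondW hk.
have e80 : 0 < e / 8 by rewrite divr_gt0.
(* For this [n] the element [b] of [B_n] has value above [nrm W y] on [y], although it belongs to
   [W]. *)
have [n n2] := n_over_logf_unbounded (nrm W y / (e / 8)).
rewrite ltr_pdivrMr // => ny.
have [b [bn _ bl]] := BXm_far hH hM hsigma far 0 (ltnW n2).
have Wb : ns_set W b by apply/W_CX/sub_BX_CX => //; exists n.
have := dot_le_nrm yW Wb; have := ler_norm (dot b y); lra.
Qed.

(** Each [w] sees only a truncation [trunc l y], so the Cauchy estimate, being uniform in [l],
    bounds all of [W] at once. *)
Lemma trunc_cvg y (e : R) : nrm_bounded W y -> 0 < e ->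
  exists k0, forall k, (k0 <= k)%N -> nrm W (y - trunc k y) <= e.
Proof.
move=> yW e0; have [k0 k0P] := trunc_cauchy yW e0; exists k0 => k k0k.
apply: nrm_le => w Ww; have [l wl] := c00_below w.
have kl := leq_maxl k l; have wl' := belowW (leq_maxr k l) wl.
rewrite dotBr -(dot_truncr _ wl') -dotBr.
apply: le_trans (k0P _ _ k0k kl); exact: (pairing_le_nrm (_ - _)).
Qed.

(** Monotonicity is known on [c00]. Replacing [y] by a close [trunc l y] with [k <= l] leaves
    [trunc k y] unchanged and costs at most [e]. *)
Lemma nrm_trunc_seq y k : nrm_bounded W y -> nrm W (trunc k y) <= nrm W y.
Proof.
move=> yW; apply/ler_addgt0Pr => e e0; have [k0 k0P] := trunc_cvg yW e0.
have l_ge := leq_maxl k k0; have := k0P _ (leq_maxr k k0); set l := maxn k k0.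
rewrite -(trunc_trunc y l_ge) => ly.
apply: le_trans (nrm_trunc_closed W_trunc k (trunc l y)) _.
have -> : nrm W (trunc l y) = nrm W (y - (y - trunc l y)) by rewrite opprB addrC subrK.
rewrite (le_trans (nrmD _ _)) ?nrmN ?lerD2l //.
rewrite -scaleN1r; apply: nrm_boundedZ; apply: nrm_boundedD => //.
rewrite -scaleN1r; apply: nrm_boundedZ; exact: nrm_bounded_c00.
Qed.

End FixedPointNorm.

(** * The basis is shrinking *)

Section ShrinkingBasis.
Variables (R : realType) (H : set (c00 R)) (M : nat -> nat) (sigma : seq (c00 R) -> nat).
Hypotheses (hH : H_conditions H) (hM : M_conditions M).
Implicit Types (a b c d x : c00 R) (s t : seq (c00 R)).
Variable W : normset R.
Hypothesis W_fix : forall w, ns_set W w <-> next_set H M sigma W w.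
Let N x := nrm W x.
Let HB := H `&` dual_ball N.

Lemma c00_ltZ (e : R) a b : e != 0 -> c00_lt a b -> c00_lt (e *: a) (e *: b).
Proof.
move=> e0 /c00_ltP[a0 b0 [k [ak bk]]]; apply/c00_ltP.
have Z0 c : c != 0 -> e *: c != 0 by rewrite scaler_eq0 negb_or e0.
split; [exact: Z0 | exact: Z0 | exists k; split].
  by move=> i ki; rewrite c00Z ak // mulr0.
exact: beyondZ.
Qed.

(** Smallness climbs from halves of dual ball elements to A, then B, then C; the unit functionals
    are treated separately. *)
Lemma small_W : small W 2^-1 (ns_set W).
Proof.
have half : 0 < 2^-1 :> R by rewrite invr_gt0.
have bounded1 D : (forall c, D c -> forall x, `|pairing c x| <= nrm W x) ->
    functionals_bounded W D.
  by move=> DN; exists 1 => c Dc x; rewrite mul1r; exact: DN.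
have WN D : D `<=` ns_set W -> functionals_bounded W D.
  by move=> DW; apply: bounded1 => c /DW Wc x; exact: pairing_le_nrm.
have s_unit : small W 2^-1 (range (unitv R)).
  have s1 i : small W 2^-1 [set unitv R i].
    split; first by apply: WN => _ ->; exact: ns_unitv.
    move=> e G e0 _ /(_ i.+2)[x Gx xi] _; exists x => // _ ->.
    by rewrite pairing_dot dot_unitv xi // normr0 addr_ge0 // ltW.
  (* Only finitely many unit functionals are nonzero on a given [u], and each vanishes on vectors
     far out. *)
  apply: small_of_large (ltW half) _ _.
    by apply: WN => _ [i _ <-]; exact: ns_unitv.
  move=> u; have [k uk] := c00_below u.
  apply: small_sub (small_bigU k s1) => _ [[i _ <-]].
  rewrite pairing_dot dot_unitv => ui; exists i => //.
  rewrite ltnNge; apply: contraTN ui => ki.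
  by rewrite uk ?normr0 -?leNgt ?ltW // leqW.
have s_half : small W 2^-1 [set 2^-1 *: g | g in HB].
  have hN c : [set 2^-1 *: g | g in HB] c -> forall x, `|pairing c x| <= 2^-1 * nrm W x.
    move=> [g [_ Bg] <-] x; rewrite pairing_dot dotZl normrM gtr0_norm //.
    by rewrite ler_pM2l //; exact: (dual_ballP W g).1.
  split; first by exists 2^-1.
  move=> e G e0 _ /(_ 0%N)[x Gx _] G1; exists x => // c /hN/(_ x).
  by have := G1 x Gx; lra.
have AN c : AX H N c -> forall x, `|pairing c x| <= nrm W x.
  move=> [p /= p2 [s [sz _ sH] <-]] x.
  rewrite pairing_dot dotZl dot_suml normrM ger0_norm ?invr_ge0 //.
  rewrite ler_pdivrMl ?ltr0n ?(ltnW p2) // (le_trans (ler_norm_sum _ _ _)) //.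
  rewrite -sz -sum1_size natr_sum mulr_suml big_seq [leRHS]big_seq ler_sum // => a as_.
  by rewrite mul1r; exact: (dual_ballP W a).1 (sH a as_).2 x.
(* An average of [n] functionals is [2 / n] times the sum of their halves; the value [1] for [n < 2]
   keeps the weights in [[0, 1]]. *)
have s_A : small W 2^-1 (AX H N).
  apply: (small_blocks (w := fun n => if (n < 2)%N then 1 else 2 / n%:R) half s_half).
  - move=> _ [g [Hg _] <-] i; rewrite c00Z normrM gtr0_norm // mulr_ile1 //.
      by rewrite invf_le1 ?ler1n.
    exact: H_coord hH g Hg i.
  - move=> n; case: ltnP => n2; first by rewrite ler01 lexx.
    have n0 : 0 < n%:R :> R by rewrite ltr0n ltnW.
    by rewrite divr_ge0 //= ler_pdivrMr // mul1r ler_nat.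
  - move=> e e0; exists (Num.truncn (2 / e)).+2 => n n0.
    have n2 : (2 <= n)%N by apply: leq_trans n0.
    have n1 : 0 < n%:R :> R by rewrite ltr0n ltnW.
    rewrite ltnNge n2 /= ltr_pdivrMr // mulrC -ltr_pdivrMr //.
    by rewrite (lt_le_trans (truncnS_gt _)) // ler_nat ltnW.
  - exact: bounded1.
  - move=> c [p /= p2 [s [sz ss sH] <-]]; exists [seq 2^-1 *: a | a <- s].
    rewrite size_map sz ltnNge p2 /=; split.
    + rewrite sorted_map; apply: sub_sorted ss => a b; exact: c00_ltZ (lt0r_neq0 half).
    + by move=> _ /mapP[a as_ ->]; exists a => //; exact: sH.
    + rewrite big_map -scaler_sumr scalerA; congr (_ *: _).
      by rewrite mulrAC divff ?mul1r.
have s_B : small W 2^-1 (BX H M sigma N).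
  apply: (small_blocks (w := fun n => (logf n%:R)^-1) half s_A).
  - by move=> d /(AX_H hH); exact: H_coord.
  - exact: logf_inv01.
  - exact: logf_inv_small.
  - by apply: WN => c /(sub_BX_CX hM)Cc; apply/W_fix; right.
  - by move=> c [m /= m0 [s [sz sB [_ ss _ _]] <-]]; exists s; rewrite sz.
have s_C : small W 2^-1 (CX H M sigma N).
  apply: (small_blocks (w := fun n => (logf n%:R)^-1) half s_B).
  - by move=> d /(BX_H hH); exact: H_coord.
  - exact: logf_inv01.
  - exact: logf_inv_small.
  - by apply: WN => c Cc; apply/W_fix; right.
  - by move=> c [m /= m0 [s [sz sB [_ ss _ _]] <-]]; exists s; rewrite sz.
by apply: small_sub (smallU s_unit s_C) => w /W_fix.
Qed.

(* A vector of [{x | N x <= 1, F x >= t}] far out can be replaced by a convex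
   combination of norm at most [3/4], which rescales to a vector on which [F]
   is at least [4 t / 3]. *)
Lemma bounded_functional_shrinking (F : c00 R -> R) (C delta : R) :
  (forall x x', F (x + x') = F x + F x') -> (forall e x, F (e *: x) = e * F x) ->
  (forall x, `|F x| <= C * nrm W x) -> 0 < delta ->
  exists k, forall x, beyond k x -> `|F x| <= delta * nrm W x.
Proof.
move=> FD FZ FC d0; apply: contrapT => nk.
pose G (r : R) := [set x : c00 R | nrm W x <= 1 /\ r <= F x].
have Gc r : convexc (G r).
  move=> u x y /andP[u0 u1] [x1 xt] [y1 yt]; split.
    rewrite (le_trans (nrm_c00D _ _ _)) // !nrm_c00Z !ger0_norm ?subr_ge0 //.
    have u1' : 0 <= 1 - u by rewrite subr_ge0.
    have := ler_wpM2l u0 x1; have := ler_wpM2l u1' y1; lra.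
  have u1' : 0 <= 1 - u by rewrite subr_ge0.
  by rewrite FD !FZ; have := ler_wpM2l u0 xt; have := ler_wpM2l u1' yt; lra.
(* The gain by the factor [4/3] is recorded as linear growth, which already exceeds every bound
   [C]. *)
have Gf : forall n : nat, cofinal (G (delta * (1 + n%:R / 3))).
  elim=> [|n IH] k.
    have [x xk Fx] : exists2 x : c00 R, beyond k x & delta * nrm W x < `|F x|.
      apply: contrapT => /forall2NP nx; apply: nk; exists k => x xk.
      by rewrite leNgt; apply/negP; have [//|] := nx x.
    have x_ge0 : 0 <= nrm W x by apply: nrm_ge0; exact: nrm_bounded_c00.
    have x_gt0 : 0 < nrm W x.
      rewrite lt0r x_ge0 andbT; apply: contraTneq Fx => x0.
      by have := FC x; rewrite x0 !mulr0 -leNgt.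
    rewrite mul0r addr0 mulr1.
    (* Scaling by [u] normalises [x] and makes the value of [F] positive. *)
    pose u := Num.sg (F x) / nrm W x.
    have Fx0 : F x != 0 by apply: contraTneq Fx => ->; rewrite normr0 -leNgt mulr_ge0 // ltW.
    exists (u *: x); last exact: beyondZ.
    split.
      rewrite nrm_c00Z normrM normr_sg Fx0 mul1r ger0_norm ?invr_ge0 //.
      by rewrite mulVf ?gt_eqF.
    rewrite FZ mulrAC -normrEsg ler_pdivlMr //; exact: ltW.
  have e0 : 0 < 4^-1 :> R by rewrite invr_gt0.
  have G1 (x : c00 R) : G (delta * (1 + n%:R / 3)) x -> nrm W x <= 1 by case.
  have [x [[x1 xt] xk] xW] := small_beyond k small_W e0 (Gc _) IH G1.
  exists ((4 / 3) *: x); last exact: beyondZ.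
  have x34 : nrm W x <= 3 / 4.
    by apply: nrm_le => w /xW; rewrite pairing_dot; lra.
  split; first by rewrite nrm_c00Z ger0_norm //; lra.
  have n0 : 0 <= n%:R :> R by [].
  have := mulr_ge0 (ltW d0) n0.
  rewrite FZ -natr1; lra.
have [m Cm] : exists m : nat, `|C| < delta * (1 + m%:R / 3).
  exists (Num.truncn (3 * `|C| / delta)).+1.
  have := truncnS_gt (3 * `|C| / delta); rewrite ltr_pdivrMr //.
  by have := normr_ge0 C; lra.
have [x [x1 xt] _] := Gf m 0%N.
have := FC x; have := ler_norm (F x).
have x_ge0 : 0 <= nrm W x by apply: nrm_ge0; exact: nrm_bounded_c00.
have : C * nrm W x <= `|C| * 1.
  by rewrite (le_trans (ler_norm _)) // normrM ler_wpM2l // ger0_norm.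
lra.
Qed.

End ShrinkingBasis.

(** * The unit vectors as a basis of the sequence space *)

Section BasisOfSequenceSpace.
Variables (R : realType) (W : normset R).
Let Y := seqspace W.
Hypothesis trunc_cvgW : forall (y : nat -> R^o) (e : R), nrm_bounded W y -> 0 < e ->
  exists k0, forall k, (k0 <= k)%N -> nrm W (y - trunc k y) <= e.
Hypothesis nrm_truncW : forall (y : nat -> R^o) k, nrm_bounded W y ->
  nrm W (trunc k y) <= nrm W y.

Lemma embed_trunc_dist (y : Y) (e : R) : 0 < e ->
  exists k0, forall k, (k0 <= k)%N -> `|y - embed W (trunc k y)| <= e.
Proof.
by move=> e0; have [k0 k0P] := trunc_cvgW (seqspace_bounded y) e0; exists k0.
Qed.

Lemma norm_embed_trunc (y : Y) k : `|embed W (trunc k y)| <= `|y|.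
Proof. exact: nrm_truncW (seqspace_bounded y). Qed.

Lemma trunc_seq1 (y : nat -> R^o) : trunc 1 y = 0.
Proof. by apply: c00E => -[|i]. Qed.

Lemma trunc_seqS (y : nat -> R^o) k :
  trunc k.+2 y = y k.+1 *: unitv R k + trunc k.+1 y.
Proof.
apply: c00E => i; rewrite c00D c00Z /=; case: i => [|i] /=; first by rewrite mulr0 addr0.
rewrite !ltnS eqSS leq_eqVlt; case: eqVneq => [->|_] /=; first by rewrite mulr1 ltnn addr0.
by rewrite mulr0 add0r.
Qed.

Lemma embed_dense : dense (range (embed W)).
Proof.
move=> O [y Oy] Oo; have /nbhs_ballP[e /= e0 yO] := open_nbhs_nbhs (conj Oo Oy).
have e20 : 0 < e / 2 by rewrite divr_gt0.
have [k /(_ k (leqnn k)) yk] := embed_trunc_dist y e20.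
exists (embed W (trunc k y)); split; last by exists (trunc k y).
by apply: yO; rewrite -ball_normE /ball_ /= (le_lt_trans yk) // ltr_pdivrMr // ltr_pMr // ltr1n.
Qed.

Definition seqspace_completion : completion (fun x : c00 R => nrm W x) :=
  @Completion R (fun x : c00 R => nrm W x) Y (embed W) (fun=> erefl) embed_dense.

(** [unitv R i] sits at coordinate [i.+1], whence the index shifts; the spurious value at index [0]
    is removed by [trunc]. *)
Lemma series_unitv (a : nat -> R) n :
  series (fun i => a i *: embed W (unitv R i)) n =
  embed W (trunc n.+1 (fun i => a i.-1 : R^o)).
Proof.
elim: n => [|n IH]; first by rewrite /series /= big_geq // trunc_seq1 linear0.
by rewrite trunc_seqS linearD linearZ /= -IH /series /= big_nat_recr //= addrC.
Qed.

Lemma unitv_basis : normalized_monotone_basis (fun i => embed W (unitv R i)).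
Proof.
split.
- move=> y; exists (fun i => y i.+1); split.
    apply/cvgrPdist_le => e e0; have [k0 k0P] := embed_trunc_dist y e0.
    exists k0 => // n /= k0n; rewrite series_unitv.
    have -> : trunc n.+1 (fun i => y i.-1.+1 : R^o) = trunc n.+1 y.
      by apply: c00E => -[|i].
    by apply: k0P; apply: leqW.
  (* Uniqueness: each coordinate is dominated by the norm, and coordinate [i.+1] of the partial sums
     is eventually [a i]. *)
  move=> a /cvgrPdist_le ya; apply/funext => i; apply/eqP; rewrite -subr_eq0 -normr_le0.
  apply/ler_addgt0Pr => e e0; rewrite add0r.
  have [k0 _ k0P] := ya e e0.
  have := k0P (maxn k0 i.+1) (leq_maxl _ _); rewrite series_unitv; apply: le_trans.
  set z := y - _.
  have -> : y i.+1 - a i = z i.+1; last exact: coord_le_nrm (seqspace_bounded z).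
  rewrite [RHS](_ : _ = y i.+1 - trunc (maxn k0 i.+1).+1 (fun j => a j.-1 : R^o) i.+1) //=.
  by rewrite ifT // !ltnS leq_maxr.
- by move=> i; exact: nrm_unitv.
- move=> a m n mn; rewrite !series_unitv.
  rewrite -(@trunc_trunc _ m.+1 n.+1) // seqspace_normE.
  by apply: nrm_truncW; exact: nrm_bounded_c00.
Qed.

(** * Reflexivity from a shrinking and boundedly complete basis *)

Section Reflexive.
Hypothesis shrinkW : forall (F : c00 R -> R) (C delta : R),
  (forall x x', F (x + x') = F x + F x') -> (forall e x, F (e *: x) = e * F x) ->
  (forall x, `|F x| <= C * nrm W x) -> 0 < delta ->
  exists k, forall x : c00 R, beyond k x -> `|F x| <= delta * nrm W x.

Implicit Types (g h : Y -> R^o).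

Lemma dual_bound g : dual g -> exists2 C, 0 < C & forall y, `|g y| <= C * `|y|.
Proof.
move=> [gl gc]; pose gL := GRing.isLinear.Build R Y R^o *:%R g gl.
pose f : {linear Y -> R^o} := HB.pack g gL.
have /linear_bounded_continuous/linear_boundedP fb : continuous f by [].
have [C C0 Cf] := pinfty_ex_gt0 fb.
by exists C.
Qed.

Lemma dual_of_bound g C : linear g -> (forall y, `|g y| <= C * `|y|) -> dual g.
Proof.
move=> gl gC; split=> //; pose gL := GRing.isLinear.Build R Y R^o *:%R g gl.
pose f : {linear Y -> R^o} := HB.pack g gL.
have : bounded_near f (nbhs 0); last by move=> /linear_bounded_continuous.
apply/linear_boundedP; near=> r => y; apply: le_trans (gC y) _.
rewrite ler_wpM2r //; near: r; apply: nbhs_pinfty_ge; exact: num_real.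
Unshelve. all: by end_near. Qed.

Lemma functional_norm_le g C : (forall y, `|y| <= 1 -> `|g y| <= C) ->
  functional_norm g <= C.
Proof.
move=> gC; apply: ge_sup => [|_ [y y1 <-]]; last exact: gC.
by exists `|g 0|, 0 => //=; rewrite normr0.
Qed.

Lemma functional_norm_ge0 g : dual g -> 0 <= functional_norm g.
Proof.
move=> /dual_bound[C C0 gC]; apply: (@le_trans _ _ `|g 0|) => //.
apply: ub_le_sup; last by exists 0 => //=; rewrite normr0.
exists C => _ [y /= y1 <-]; rewrite (le_trans (gC y)) //.
by rewrite ler_piMr // ltW.
Qed.

Lemma dual_dot (a : c00 R) : dual (fun y : Y => dot a y : R^o).
Proof.
apply: (@dual_of_bound _ (l1_norm a)).
  by move=> c u v; rewrite [LHS](dotDr a (c *: (u : nat -> R^o)) v) dotZr.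
move=> y; rewrite mulrC; have [k ak] := c00_below a.
rewrite (@eq_dot _ k a y (fun i => if i is 0 then 0 else y i)) //; last by case.
apply: dot_le_l1 => -[|i]; first by rewrite normr0.
exact: coord_le_nrm (seqspace_bounded y).
Qed.

(** A linear functional composed with a basis projection is given by an element of [c00], on which
    [phi] can be computed coordinatewise. *)
Lemma dual_truncE g k : linear g ->
  (fun z : Y => g (embed W (trunc k.+1 z))) =
  (fun z : Y => dot (trunc k.+1 (fun j => g (embed W (unitv R j.-1)))) z).
Proof.
move=> gl; have gD u v : g (u + v) = g u + g v by rewrite -[u]scale1r gl !scale1r.
have g0 : g 0 = 0 by apply: (addrI (g 0)); rewrite -gD !addr0.
have gZ c u : g (c *: u) = c * g u by rewrite -[c *: u]addr0 gl g0 addr0.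
apply/funext => z; elim: k => [|k IH]; first by rewrite !trunc_seq1 linear0 dot0l.
by rewrite !trunc_seqS linearD linearZ /= gD gZ IH dotDl dotZl dot_unitv mulrC.
Qed.

(** The values of [phi] on the coordinate functionals form a sequence [y] of finite norm, as [W]
    lies in the dual unit ball. Then [phi] and evaluation at [y] agree on finitely supported
    functionals, which approximate every [g] in norm by shrinking. *)
Lemma seqspace_reflexive : reflexive_space Y.
Proof.
move=> phi [phiL [K phiK]].
have {}phiK g C : dual g -> (forall y, `|y| <= 1 -> `|g y| <= C) -> `|phi g| <= `|K| * C.
  move=> gd gC; rewrite (le_trans (phiK g gd)) //.
  apply: (@le_trans _ _ (`|K| * functional_norm g)).
    by rewrite ler_wpM2r ?ler_norm // functional_norm_ge0.
  by rewrite ler_wpM2l // functional_norm_le.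
pose y : nat -> R^o := fun i => phi (fun z : Y => dot (unitv R i.-1) z).
have phi_dot k (a : c00 R) : phi (fun z : Y => dot (trunc k.+1 a) z) = dot (trunc k.+1 a) y.
  elim: k => [|k IH].
    rewrite trunc_seq1 dot0l; have d0 := dual_dot 0.
    have E : (fun z : Y => dot 0 z : R^o) = 1 *: (fun z : Y => dot 0 z : R^o) + (fun z : Y => dot 0 z : R^o).
      by apply/funext => z; rewrite [RHS](_ : _ = 1 * dot 0 z + dot 0 z) // !dot0l mulr0 addr0.
    have := phiL 1 _ _ d0 d0; rewrite -E mul1r => E2.
    by apply: (addrI (phi (fun z : Y => dot 0 z))); rewrite -E2 addr0.
  rewrite trunc_seqS dotDl dotZl dot_unitv -IH -phiL; [|exact: dual_dot|exact: dual_dot].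
  by congr phi; apply/funext => z; rewrite dotDl dotZl.
have {}phi_dot (a : c00 R) : phi (fun z : Y => dot a z) = dot a y.
  have [k ak] := c00_below a; have ak1 := belowW (leqnSn k) ak.
  by have := phi_dot k a; rewrite trunc_id.
(* Because of the shift [i.-1], the value [y 0] repeats [y 1]; it is reset to [0]. *)
pose y' : nat -> R^o := fun i => if i is 0 then 0 else y i.
have dot_y' (a : c00 R) : dot a y' = dot a y.
  by have [k ak] := c00_below a; apply: (eq_dot ak); case.
have y'P : y' \in seqspace_pred W.
  apply/seqspace_predP; split=> //; exists (`|K| * 1) => w Ww.
  rewrite dot_y' -phi_dot; apply: phiK; first exact: dual_dot.
  by move=> z; apply: le_trans; exact: dot_le_norm.
exists (SeqSpace y'P : Y) => g gd; set yY := SeqSpace y'P.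
have [gl gc] := gd; have [C C0 gC] := dual_bound gd.
have gD u v : g (u + v) = g u + g v by rewrite -[u]scale1r gl !scale1r.
have g0 : g 0 = 0 by apply: (addrI (g 0)); rewrite -gD !addr0.
have gZ c u : g (c *: u) = c * g u by rewrite -[c *: u]addr0 gl g0 addr0.
have gB u v : g (u - v) = g u - g v by rewrite gD -scaleN1r gZ mulN1r.
suff close (e : R) : 0 < e -> `|phi g - g yY| <= `|K| * (3 * e) + C * e.
  apply/eqP; rewrite -subr_eq0 -normr_le0; apply/ler_addgt0Pr => e e0; rewrite add0r.
  have S0 : 0 < `|K| * 3 + C by rewrite ltr_wpDl // mulr_ge0.
  have := close (e / (`|K| * 3 + C)) (divr_gt0 e0 S0); congr (_ <= _).
  by field; rewrite gt_eqF.
move=> e0; have [k0 k0P] := embed_trunc_dist yY e0.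
have [||| k1 k1P] := @shrinkW (fun x => g (embed W x)) C e _ _ _ e0.
- by move=> x x'; rewrite linearD gD.
- by move=> c x; rewrite linearZ gZ.
- by move=> x; exact: gC.
set k := maxn k0 k1.
have gkE := dual_truncE k gl; set a := trunc _ _ in gkE.
have gk_dual : dual (fun z : Y => g (embed W (trunc k.+1 z))).
  by rewrite gkE; exact: dual_dot.
(* The tail of [g], of norm at most [3 * e]; the rest of [g] is the finitely supported functional
   [a]. *)
pose r : Y -> R^o := fun z => g z - g (embed W (trunc k.+1 z)).
have r_dual : dual r.
  apply: (@dual_of_bound _ (C * 2)).
    move=> c u v; rewrite /r gl [trunc _ _](trunc_seqD _ (c *: (u : nat -> R^o)) v).
    rewrite trunc_seqZ linearD linearZ /= gl [c *: (_ - _)]scalerBr opprD.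
    by rewrite addrACA.
  move=> z; rewrite /r -gB (le_trans (gC _)) // -mulrA ler_wpM2l ?(ltW C0) //.
  rewrite (le_trans (ler_normB _ _)) //.
  by have := norm_embed_trunc z k.+1; lra.
have phi_split : phi g = phi r + dot a yY.
  have -> : g = 1 *: r + (fun z : Y => g (embed W (trunc k.+1 z))).
    by apply/funext => z; rewrite [RHS](_ : _ = 1 * r z + g (embed W (trunc k.+1 z))) // mul1r subrK.
  by rewrite phiL // mul1r gkE phi_dot -dot_y'.
have -> : phi g - g yY = phi r - (g (yY - embed W (trunc k.+1 yY))).
  rewrite phi_split gB -(congr1 (fun f : Y -> R^o => f yY) gkE) /=; ring.
rewrite (le_trans (ler_normB _ _)) // lerD //.
  apply: phiK => // z z1; rewrite /r -gB.
  (* The shrinking estimate concerns finitely supported vectors, so [z] is cut at [l] at a cost of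
     [C * (e / C) = e]. The remaining block has norm at most [2] and contributes [2 * e]. *)
  have [l0 l0P] := embed_trunc_dist z (divr_gt0 e0 C0).
  set l := maxn l0 k.+1.
  have -> : z - embed W (trunc k.+1 z) =
      (z - embed W (trunc l z)) + embed W (trunc l z - trunc k.+1 z).
    by rewrite linearB /= addrA subrK.
  rewrite gD (le_trans (ler_normD _ _)) // (_ : 3 * e = e + 2 * e); last by ring.
  apply: lerD.
    rewrite (le_trans (gC _)) // mulrC -ler_pdivlMr //.
    by apply: l0P; exact: leq_maxl.
  have bk : beyond k1 (trunc l z - trunc k.+1 z).
    move=> i ik; rewrite c00D c00N /=.
    have ik1 : (i < k.+1)%N by rewrite ltnW // ltnS (leq_trans ik) // leq_maxr.
    by rewrite ik1 (leq_trans ik1 (leq_maxr _ _)) subrr.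
  rewrite (le_trans (k1P _ bk)) // mulrC ler_wpM2r ?(ltW e0) //.
  have tz j : nrm W (trunc j z) <= 1 by apply: le_trans z1; exact: norm_embed_trunc.
  rewrite (le_trans (nrm_c00D _ _ _)) // nrm_c00N.
  by have := tz l; have := tz k.+1; lra.
rewrite (le_trans (gC _)) // ler_wpM2l ?(ltW C0) //.
by apply: k0P; rewrite leqW // leq_maxl.
Qed.

End Reflexive.
End BasisOfSequenceSpace.

(** * The norm of the fixed point and its reflexive completion *)

Theorem proposition3p1 (R : realType) (H : set (c00 R)) (hH : H_conditions H)
    (M : nat -> nat) (hM : M_conditions M)
    (sigma : seq (c00 R) -> nat) (hsigma : sigma_conditions H sigma) :
  exists N : c00 R -> R,
    [/\ class_N N,
        forall x : c00 R,
          (N x)%:E = maxe (sup_norm x) (set_norm (CX H M sigma N) x) &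
        exists Y : completion N, reflexive_space Y].
Proof.
have [W Wt Wf] := fixed_point hH hM hsigma.
have tc := trunc_cvg hH hM hsigma Wt Wf.
have nt := nrm_trunc_seq hH hM hsigma Wt Wf.
exists (fun x => nrm W x); split.
- split; [exact: is_norm_nrm | | exact: dual_norm_unitv].
  by exists (seqspace_completion tc); exact: (unitv_basis tc nt).
- exact: nrm_eq Wf.
- exists (seqspace_completion tc); apply: (seqspace_reflexive tc nt).
  move=> F C d FD FZ FC d0.
  exact: (bounded_functional_shrinking hH hM Wf FD FZ FC d0).
Qed.
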